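(* Let $X_n$ be the number of occupied seats at the end of the random unfriendly seating process started from the empty $2\times n$ seat configuration $\mathscr{X}_n$. Then, as $n\to\infty$, the mean of $X_n$ satisfies \[ \mathbb{E}(X_n)=\mu n+c_1+O\left(\frac{1}{(n+3)!}\right), \] where $\mu:=1-\frac{e^{-1}}{2}$, $\phi:=2\Phi(1)-1$ and \[ c_1:=\frac{e^{-1}}{2}\left(\sqrt{2\pi e}\,\phi-1\right), \] and the variance of $X_n$ satisfies \[ \mathbb{V}(X_n)=\sigma^2 n+c_2+O\left(\frac{2^n}{(n+4)!}\right), \] where $\sigma:=\sqrt{\tfrac34}\,e^{-1}$ and \[ c_2:=\frac{e^{-2}}{4}\left(-\pi e\,\phi^2-2\sqrt{2\pi e}\,\phi+5\right). \]
   Context: A seat configuration is a finite set $S$ of seats $(r,c)$ with row $r\in\{\text{top},\text{bottom}\}$ and column $c\in\mathbb{Z}$. Two seats are neighbors if they lie in the same row in consecutive columns, or in the same column in opposite rows. The random unfriendly seating process started from $S$: at each step, a seat is chosen uniformly at random among the currently available seats (initially all seats of $S$ are available); it becomes occupied, and it together with all its neighbors in $S$ becomes unavailable; choices are made until no seat is available. (Equivalently: a uniform random seat is proposed and rejected if it is not available.) $\mathscr{X}_n$ is the configuration with $2n$ seats: both rows have columns $1,\dots,n$. $\Phi$ is the standard normal distribution function. *)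

(* Defs.v *)
From HB Require Import structures.
From mathcomp Require Import all_boot all_order all_algebra finmap.
From mathcomp Require Import all_classical all_reals all_analysis.

Set Implicit Arguments.
Unset Strict Implicit.
Unset Printing Implicit Defensive.

Import Order.TTheory GRing.Theory Num.Theory.
Import numFieldNormedType.Exports.

Local Open Scope classical_set_scope.
Local Open Scope ring_scope.

(* The row is [true] for top and [false] for bottom. *)
Definition seat : Type := (bool * int)%type.

HB.instance Definition _ := Countable.on seat.

Definition neighbor (s t : seat) : bool :=
  ((s.1 == t.1) && ((s.2 == t.2 + 1) || (t.2 == s.2 + 1)))
  || ((s.1 != t.1) && (s.2 == t.2)).

(* The seats that remain available, out of the available seats [A], once [s]
   becomes occupied. *)
Definition occupy (A : {fset seat}) (s : seat) : {fset seat} :=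
  [fset t in A | (t != s) && ~~ neighbor s t]%fset.

(* A run lists the seats in the order in which they become occupied. *)
Definition run : Type := seq seat.

HB.instance Definition _ := Choice.on run.
HB.instance Definition _ := isPointed.Build run [::].
HB.instance Definition _ := @isMeasurable.Build default_measure_display
  run discrete_measurable discrete_measurable0
  discrete_measurableC discrete_measurableU.

Section seating_process.
Context (R : realType).

(* The probability that, when exactly the seats of [A] are available, the
   seats that become occupied until no seat is available are those of [w], in
   that order. *)
Fixpoint run_pmf (A : {fset seat}) (w : seq seat) : R :=
  match w with
  | [::] => (A == fset0)%:R
  | s :: w' => if s \in A then #|` A|%:R^-1 * run_pmf (occupy A s) w' else 0
  end.

Lemma run_pmf_ge0 A w : 0 <= run_pmf A w.
Proof.
elim: w A => [|s w IH] A /=; first exact: ler0n.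
by case: ifP => // _; rewrite mulr_ge0// invr_ge0 ler0n.
Qed.

Lemma occupy_lt A s : s \in A -> (#|` occupy A s| < #|` A|)%N.
Proof.
move=> sA; apply: fproper_ltn_card; rewrite fproperEneq; apply/andP; split.
  apply/eqP => oA; move: sA; rewrite -oA !inE/= eqxx/=.
  by rewrite andbF.
by apply/fsubsetP => t; rewrite !inE => /andP[].
Qed.

Lemma esumZ_le (T : choiceType) (c : R) (f : T -> \bar R) : 0 <= c ->
  (forall x, 0 <= f x)%E ->
  (\esum_(x in [set: T]) (c%:E * f x) <= c%:E * \esum_(x in [set: T]) f x)%E.
Proof.
move=> c0 f0; apply: ge_ereal_sup => _ [X [finX _] <-].
rewrite -ge0_mule_fsumr//; apply: lee_wpmul2l; first by rewrite lee_fin.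
by apply: esum_ge; exists X.
Qed.

Lemma esumZ (T : choiceType) (c : R) (f : T -> \bar R) : 0 < c ->
  (forall x, 0 <= f x)%E ->
  (\esum_(x in [set: T]) (c%:E * f x) = c%:E * \esum_(x in [set: T]) f x)%E.
Proof.
move=> c0 f0; apply/eqP; rewrite eq_le esumZ_le  ?(ltW c0)//.
rewrite -lee_pdivlMl//.
have -> : (\esum_(x in [set: T]) f x =
    \esum_(x in [set: T]) (c^-1%:E * (c%:E * f x)))%E.
  by apply: eq_esum => x _; rewrite muleA -EFinM mulVf ?gt_eqF// mul1e.
by apply: esumZ_le; rewrite ?invr_ge0 ?(ltW c0)// => x; rewrite mule_ge0 ?lee_fin ?(ltW c0).
Qed.

Lemma run_pmf_total A : (\esum_(w in [set: run]) (run_pmf A w)%:E = 1)%E.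
Proof.
have [n] := ubnP #|` A|; elim: n A => // n IH A; rewrite ltnS => An.
have ge0 (B : {fset seat}) (w : run) : (0 <= (run_pmf B w)%:E)%E.
  by rewrite lee_fin run_pmf_ge0.
have cons_inj : set_inj [set: seat * run] (fun p => p.1 :: p.2 : run).
  by move=> [s w] [t v] _ _ [-> ->].
rewrite (esumID [set [::] : run])//.
rewrite setTI esum_set1 ?ge0//= setTI.
have -> : ~` [set [::] : run] =
    (fun p : seat * run => p.1 :: p.2 : run) @` [set: seat * run].
  apply/seteqP; split=> [[|s w]//= _|_ [[s w] _ <-]//].
  by exists (s, w).
rewrite (esum_image _ _ (fun w => (run_pmf A w)%:E))//.
have -> : [set: seat * run] = [set: seat] `*`` (fun=> [set: run]).
  by apply/seteqP; split.
rewrite -(@esum_esum R seat run _ (fun=> setT)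
  (fun s w => (run_pmf A (s :: w))%:E)); last first.
  by move=> s w _ _; exact: ge0.
have inner s : (\esum_(w in [set: run]) (run_pmf A (s :: w))%:E =
    if s \in A then (#|` A|%:R^-1)%:E else 0)%E.
  rewrite /=; case: ifPn => sA; last by rewrite esum1.
  have sI := IH (occupy A s) (leq_trans (occupy_lt sA) An).
  rewrite -[RHS]mule1 -sI -esumZ// invr_gt0 ltr0n cardfs_gt0.
  by apply/fset0Pn; exists s.
under eq_esum do rewrite inner.
have -> : (\esum_(s in [set: seat]) (if s \in A then #|` A|%:R^-1%:E else 0) =
    \sum_(s <- A) (#|` A|%:R^-1 : R)%:E)%E.
  rewrite fsbig_seq ?fset_uniq// -esum_fset//.
  rewrite [RHS]esum_mkcond; apply: eq_esum => s _.
  by rewrite mem_setE.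
rewrite sumEFin -EFinD; congr (_%:E).
case: eqVneq => [->|A0]; first by rewrite big_seq_fset0 addr0.
rewrite add0r big_tnth sumr_const card_ord -[LHS]mulr_natr mulVf//.
by rewrite pnatr_eq0 cardfs_eq0.
Qed.

Definition seating_law (S : {fset seat}) : set run -> \bar R :=
  fun U => (\esum_(w in U) (run_pmf S w)%:E)%E.

Section seating_law_probability.
Variable S : {fset seat}.

Let seating_law0 : seating_law S set0 = 0%E.
Proof. exact: esum_set0. Qed.

Let seating_law_ge0 U : (0 <= seating_law S U)%E.
Proof. by apply: esum_ge0 => w _; rewrite lee_fin run_pmf_ge0. Qed.

Let seating_law_sigma_additive : semi_sigma_additive (seating_law S).
Proof.
move=> F _ tF _; have ge0 (w : run) : (0 <= (run_pmf S w)%:E)%E.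
  by rewrite lee_fin run_pmf_ge0.
rewrite {2}/seating_law nneseries_sum_bigcup//.
by apply: is_cvg_nneseries => k _ _; exact: seating_law_ge0.
Qed.

HB.instance Definition _ := isMeasure.Build _ _ _ (seating_law S)
  seating_law0 seating_law_ge0 seating_law_sigma_additive.

Let seating_law_setT : seating_law S [set: run] = 1%E.
Proof. exact: run_pmf_total. Qed.

HB.instance Definition _ :=
  Measure_isProbability.Build _ _ _ (seating_law S) seating_law_setT.

End seating_law_probability.

Definition occupied (w : run) : R := (size w)%:R.

Let measurable_occupied : measurable_fun [set: run] occupied.
Proof. by []. Qed.

HB.instance Definition _ :=
  isMeasurableFun.Build _ _ _ _ occupied measurable_occupied.

Definition Phi (x : R) : R := fine (normal_prob 0 1 `]-oo, x]).

End seating_process.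

Definition ladder (n : nat) : {fset seat} :=
  [fset (r, c%:Z) | r in [:: true; false], c in iota 1 n]%fset.

(* Main.v *)
Require Import Defs.
From HB Require Import structures.
From mathcomp Require Import all_boot all_order all_algebra finmap.
From mathcomp Require Import all_classical all_reals all_analysis.
From mathcomp Require Import measurable_realfun.
From mathcomp Require Import ring lra zify.

Import Order.TTheory GRing.Theory Num.Theory.
Import numFieldNormedType.Exports.

Set Implicit Arguments.
Unset Strict Implicit.
Unset Printing Implicit Defensive.

Local Open Scope classical_set_scope.
Local Open Scope ring_scope.

(** Occupying the first seat, in column [c] say, cuts the ladder into two pieces
    that do not see each other: the columns before [c] and the columns after [c],
    each deprived of one seat of its end column, the neighbor of the occupied
    seat.  The number of occupied seats of a piece is therefore one plus a sum of
    two independent numbers of the same kind ([occupy_shape], [pgf_disjoint]),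
    and only three families of pieces occur: the ladder itself ([whole]), ladders
    with one notched end ([outer]) and ladders with two notched ends, whose
    generating functions depend on the relative position of the notches.  The
    notch left by a random seat lies in either row with the same probability, so
    only the average over the two positions matters ([inner]), and this average
    satisfies a recurrence of its own ([inner_rec], [outer_rec], [whole_rec]):

      [(n - 1) I_n = x sum I_j I_(n-1-j)],  [(2n - 1) O_n = 2 x sum O_j I_(n-1-j)],
      [n W_n = x sum O_j O_(n-1-j)],  with [I_0 = 1/2].

    If the numbers are centred at [mu n + mu - 1], [mu n] and [mu n + 1 - mu], the
    added one is absorbed exactly, so that the moments about these centres
    convolve ([mom1_conv], [mom2_conv]).  Their generating series in [z] solve
    linear differential equations, which have closed forms in [exp (- z)], powers
    of [1 - z], and the series [sum z^n / (2n - 1)!!]; the closed forms come from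
    variation of constants, and checking them is algebra ([inner_m1_ode],
    [inner_m2_ode], [outer_dm1_ode], [outer_dm2_ode]).

    The only singularity is a pole at [1].  Its principal part gives the terms of
    the expansion that are polynomial in [n], and the constants are values at [1]
    of entire series.  One of them is [K = sum 1 / (2n - 1)!!], and integrating
    [exp (- s^2 / 2)] over [[0, 1]] by parts repeatedly gives
    [2 K = sqrt (2 pi e) phi] ([at1_inv_odd_fact]).

    What remains is entire, and its coefficients are bounded by
    [C M ^ n / (n + k)!] ([decays]).  Dividing an entire series that vanishes at
    [1] by [1 - z] increases [k] by one ([decays_tail]), and so does solving the
    equation of the one-notched pieces ([decays_outer_op]).  At the level of
    [outer], what is left of the series after subtraction of pole and constant
    vanishes twice at [1], as the equation read at [1] shows ([at1_outer_op]);
    counting the gains yields [M = 1], [k = 3] for the mean.  The variance involves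
    products of two such series, whose coefficients are sums of binomial
    coefficients over a factorial: this is the origin of [2 ^ n], with
    [M = 2], [k = 4] ([outer_dm1_expansion], [outer_dm2_expansion]). *)

(** * Formal power series with real coefficients *)

(** A synonym of [nat -> R], so that the product can be the Cauchy product. *)
Definition fps (R : realType) : Type := nat -> R.

HB.instance Definition _ (R : realType) := GRing.Zmodule.copy (fps R) (nat -> R).

Section fps_ring.
Context (R : realType).
Implicit Types (f g h : fps R) (c : R).

Lemma fpsP f g : (forall n, f n = g n) -> f = g.
Proof. exact: funext. Qed.

Definition fps_mul f g : fps R := fun n => \sum_(i < n.+1) f i * g (n - i)%N.
Definition fps_const c : fps R := fun n => if n == 0 then c else 0.

(** The ring axioms and the Leibniz rule are inherited from polynomials, since a
    coefficient of a product only depends on truncations of the factors. *)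
Definition trunc n f : {poly R} := \poly_(i < n.+1) f i.

Lemma coef_truncM N n f g : (n <= N)%N ->
  (trunc N f * trunc N g)`_n = fps_mul f g n.
Proof.
move=> nN; rewrite coefM; apply: eq_bigr => i _.
by rewrite !coef_poly !ltnS (leq_trans _ nN) ?(leq_trans (leq_subr _ _) nN)// -ltnS.
Qed.

Lemma eq_coefM n (p p' q q' : {poly R}) :
  (forall i, (i <= n)%N -> p`_i = p'`_i) ->
  (forall i, (i <= n)%N -> q`_i = q'`_i) ->
  (p * q)`_n = (p' * q')`_n.
Proof.
move=> pp qq; rewrite !coefM; apply: eq_bigr => i _.
by rewrite pp ?qq// ?leq_subr// -ltnS.
Qed.

Lemma coef_trunc N n f : (n <= N)%N -> (trunc N f)`_n = f n.
Proof. by move=> nN; rewrite coef_poly ltnS nN. Qed.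

Let mulA : associative fps_mul.
Proof.
move=> f g h; apply: fpsP => n.
rewrite -(coef_truncM _ _ (leqnn n)) -[RHS](coef_truncM _ _ (leqnn n)).
transitivity ((trunc n f * (trunc n g * trunc n h))`_n).
  by apply: eq_coefM => i ni //; rewrite coef_trunc// coef_truncM.
by rewrite mulrA; apply: eq_coefM => i ni //; rewrite [RHS]coef_trunc// coef_truncM.
Qed.

Let mulC : commutative fps_mul.
Proof.
by move=> f g; apply: fpsP => n; rewrite -!(coef_truncM _ _ (leqnn n)) mulrC.
Qed.

Let mul1 : left_id (fps_const 1) fps_mul.
Proof.
move=> f; apply: fpsP => n; rewrite /fps_mul big_ord_recl/= subn0 mul1r.
by rewrite big1 ?addr0// => i _; rewrite /fps_const/= mul0r.
Qed.

Let mulDl : left_distributive fps_mul +%R.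
Proof.
move=> f g h; apply: fpsP => n.
transitivity (\sum_(i < n.+1) (f i * h (n - i)%N + g i * h (n - i)%N)).
  by apply: eq_bigr => i _; rewrite -mulrDl.
exact: big_split.
Qed.

Let one_neq0 : fps_const 1 != 0 :> fps R.
Proof.
by apply/eqP => /(congr1 (fun f : fps R => f 0)) /eqP; rewrite oner_eq0.
Qed.

HB.instance Definition _ := GRing.Zmodule_isComNzRing.Build (fps R)
  mulA mulC mul1 mulDl one_neq0.

Lemma fpsM f g n : (f * g) n = \sum_(i < n.+1) f i * g (n - i)%N.
Proof. by []. Qed.

Lemma fpsD f g n : (f + g) n = f n + g n. Proof. by []. Qed.
Lemma fpsN f n : (- f) n = - f n. Proof. by []. Qed.
Lemma fps1 n : (1 : fps R) n = (n == 0)%:R.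
Proof. by rewrite [LHS]/(fps_const 1 n) /fps_const; case: eqP. Qed.

Lemma fpsMn f k n : (f *+ k) n = f n *+ k.
Proof. by elim: k => [|k IH]; rewrite ?mulr0n// !mulrS fpsD IH. Qed.

Let const_add : additive fps_const.
Proof. by move=> a b; apply: fpsP => -[|n] //=; rewrite [RHS]fpsD fpsN /= subr0. Qed.

Lemma fps_constE c f n : (fps_const c * f) n = c * f n.
Proof.
rewrite fpsM big_ord_recl/= subn0 big1 ?addr0// => i _.
by rewrite /fps_const/= mul0r.
Qed.

Let const_mul : multiplicative fps_const.
Proof.
split=> // a b; apply: fpsP => -[|n]; rewrite [RHS]fps_constE//=.
by rewrite mulr0.
Qed.

HB.instance Definition _ := GRing.isAdditive.Build R (fps R) fps_const const_add.
HB.instance Definition _ := GRing.isMultiplicative.Build R (fps R) fps_const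
  const_mul.

Definition fpsX : fps R := fun n => (n == 1)%:R.

Lemma fpsX0 f : (fpsX * f) 0 = 0.
Proof. by rewrite fpsM big_ord_recl big_ord0 mul0r addr0. Qed.

Lemma fpsXS f n : (fpsX * f) n.+1 = f n.
Proof.
rewrite fpsM big_ord_recl mul0r add0r big_ord_recl/= subSS subn0 mul1r.
by rewrite big1 ?addr0// => i _; rewrite /fpsX/= mul0r.
Qed.

Definition fderiv f : fps R := fun n => n.+1%:R * f n.+1.

Let fderiv_add : additive fderiv.
Proof. by move=> f g; apply: fpsP => n; rewrite /fderiv fpsD fpsN mulrDr mulrN. Qed.

HB.instance Definition _ := GRing.isAdditive.Build (fps R) (fps R) fderiv fderiv_add.

Lemma fderivE f n : fderiv f n = n.+1%:R * f n.+1. Proof. by []. Qed.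

Lemma fderivM f g : fderiv (f * g) = fderiv f * g + f * fderiv g.
Proof.
apply: fpsP => n; rewrite fpsD fderivE.
rewrite -[(f * g) _](coef_truncM _ _ (leqnn n.+1)) mulr_natl -coef_deriv derivM coefD.
congr (_ + _); rewrite coefM fpsM; apply: eq_bigr => i _; congr (_ * _).
- by rewrite coef_deriv coef_trunc ?ltn_ord// fderivE mulr_natl.
- by rewrite coef_trunc// (leq_trans (leq_subr _ _)).
- by rewrite coef_trunc// ltnW.
- by rewrite coef_deriv coef_trunc ?ltnS ?leq_subr// fderivE mulr_natl.
Qed.

Lemma fderiv_const c : fderiv (fps_const c) = 0.
Proof. by apply: fpsP => n; rewrite fderivE mulr0. Qed.

Lemma fderiv1 : fderiv 1 = 0.
Proof. exact: fderiv_const. Qed.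

Lemma fderivX : fderiv fpsX = 1.
Proof.
apply: fpsP => n; rewrite fderivE fps1 /fpsX eqSS.
by case: eqP => [->|]; rewrite ?mulr0 ?mulr1.
Qed.

(** The series of [1 / (1 - z)]. *)
Definition geom : fps R := fun=> 1.
Local Notation y := (1 - fpsX).

Lemma y_geom : y * geom = 1.
Proof.
apply: fpsP => -[|n]; rewrite mulrBl mul1r fpsD fpsN fps1 ?fpsX0 ?fpsXS/=.
  by rewrite subr0.
by rewrite subrr.
Qed.

Lemma y_lreg f g : y * f = y * g -> f = g.
Proof.
move=> /(congr1 (fun h => geom * h)); rewrite !mulrA [geom * _]mulrC y_geom.
by rewrite !mul1r.
Qed.

Lemma fderiv_geom : fderiv geom = geom ^+ 2.
Proof.
have /(congr1 fderiv) := y_geom; rewrite fderivM raddfB/= fderiv1 fderivX sub0r.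
move=> e; apply: y_lreg; rewrite expr2 mulrA y_geom mul1r.
by move/eqP: e; rewrite mulN1r addrC subr_eq0 => /eqP.
Qed.

End fps_ring.

(** * Coefficients bounded by powers over factorials *)
Section decay.
Context (R : realType).
Local Notation y := (1 - fpsX R).
Implicit Types (f g h : fps R) (c : R) (M k l n : nat).

Definition decay_bound M k n : R := M%:R ^+ n / (n + k)`!%:R.

Definition decays M k f := exists C : R, forall n, `|f n| <= C * decay_bound M k n.

Lemma decay_bound_ge0 M k n : 0 <= decay_bound M k n.
Proof. by rewrite divr_ge0. Qed.

Lemma decay_bound_gt0 M k n : (0 < M)%N -> 0 < decay_bound M k n.
Proof. by move=> M0; rewrite divr_gt0 ?exprn_gt0 ?ltr0n ?fact_gt0. Qed.

Lemma decays_coef_ge0 M k C f : (0 < M)%N ->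
  (forall n, `|f n| <= C * decay_bound M k n) -> 0 <= C.
Proof.
move=> M0 fC; rewrite -(pmulr_lge0 _ (decay_bound_gt0 k 0 M0)).
exact: le_trans (fC 0).
Qed.

(** A finite number of coefficients never matters, hence constants and
    polynomials belong to all these classes. *)
Lemma decays_eventually M k N C f : (0 < M)%N ->
  (forall n, (N <= n)%N -> `|f n| <= C * decay_bound M k n) -> decays M k f.
Proof.
move=> M0 fC; exists (`|C| + \sum_(i < N) `|f i| / decay_bound M k i) => n.
have sum_ge0 : 0 <= \sum_(i < N) `|f i| / decay_bound M k i.
  by apply: sumr_ge0 => i _; rewrite divr_ge0 ?decay_bound_ge0.
have [/fC fn|nN] := leqP N n.
  apply: le_trans fn _; rewrite ler_wpM2r ?decay_bound_ge0//.
  by rewrite (le_trans (ler_norm C))// lerDl.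
rewrite -ler_pdivrMr ?decay_bound_gt0// (bigD1 (Ordinal nN))//= addrCA lerDl.
by rewrite addr_ge0// sumr_ge0// => i _; rewrite divr_ge0 ?decay_bound_ge0.
Qed.

Lemma decaysD M k f g : decays M k f -> decays M k g -> decays M k (f + g).
Proof.
move=> [C fC] [C' gC]; exists (C + C') => n; rewrite fpsD mulrDl.
by rewrite (le_trans (ler_normD _ _))// lerD.
Qed.

Lemma decaysN M k f : decays M k f -> decays M k (- f).
Proof. by move=> [C fC]; exists C => n; rewrite fpsN normrN. Qed.

Lemma decaysB M k f g : decays M k f -> decays M k g -> decays M k (f - g).
Proof. by move=> df dg; apply: decaysD => //; apply: decaysN. Qed.

Lemma decays_constM M k c f : decays M k f -> decays M k (fps_const c * f).
Proof.
move=> [C fC]; exists (`|c| * C) => n.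
by rewrite fps_constE normrM -mulrA ler_wpM2l.
Qed.

Lemma decays_natM M k j f : decays M k f -> decays M k (j%:R * f).
Proof. by rewrite -(rmorph_nat (fps_const (R:=R)) j); apply: decays_constM. Qed.

Lemma decays_const M k c : (0 < M)%N -> decays M k (fps_const c).
Proof.
by move=> M0; apply: (@decays_eventually _ _ 1 0) => // -[//|n] _;
  rewrite normr0 mul0r.
Qed.

Lemma decaysX M k : (0 < M)%N -> decays M k (fpsX R).
Proof.
by move=> M0; apply: (@decays_eventually _ _ 2 0) => // -[//|[|n]] //;
  rewrite normr0 mul0r.
Qed.

Lemma decaysS M k f : decays M k.+1 f -> decays M k f.
Proof.
move=> [C fC]; have C0 : 0 <= C.
  have := le_trans (normr_ge0 _) (fC 0); rewrite /decay_bound expr0 mul1r.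
  by rewrite pmulr_lge0// invr_gt0 ltr0n fact_gt0.
exists C => n; apply: le_trans (fC n) _; rewrite ler_wpM2l// /decay_bound.
rewrite ler_wpM2l ?exprn_ge0 ?ler0n// lef_pV2 ?posrE ?ltr0n ?fact_gt0//.
by rewrite ler_nat addnS factS leq_pmull.
Qed.

Lemma decays_le M k l f : (l <= k)%N -> decays M k f -> decays M l f.
Proof. by move=> /subnK <-; elim: (k - l)%N => // n IH /decaysS. Qed.

Lemma decaysXM M k f : (0 < M)%N -> decays M k.+1 f -> decays M k (fpsX R * f).
Proof.
move=> M0 [C fC]; apply: (@decays_eventually _ _ 1 C) => // -[//|n] _.
rewrite fpsXS (le_trans (fC n))// ler_wpM2l ?(decays_coef_ge0 M0 fC)//.
rewrite /decay_bound addSnnS ler_wpM2r ?invr_ge0// -natrX -natrX ler_nat.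
by rewrite expnS leq_pmull.
Qed.

Lemma decaysyM M k f : (0 < M)%N -> decays M k.+1 f -> decays M k (y * f).
Proof.
move=> M0 fM; rewrite mulrBl mul1r; apply: decaysB; first exact: decaysS.
exact: decaysXM.
Qed.

(** A product of two bounds is, up to the factorial, a partial sum of the
    binomial expansion of [(a + b) ^ (n + k + l)]. *)
Lemma sum_binom_shift n k l a b :
  (\sum_(i < n.+1) 'C(n + k + l, i + k) * (a ^ (i + k) * b ^ (n - i + l))
    <= (a + b) ^ (n + k + l))%N.
Proof.
rewrite (addnC a b) expnDn.
rewrite -(big_mkord xpredT (fun i =>
  'C(n + k + l, i + k) * (a ^ (i + k) * b ^ (n - i + l))))%N.
rewrite -(big_mkord xpredT (fun i =>
  'C(n + k + l, i) * (b ^ (n + k + l - i) * a ^ i)))%N.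
rewrite [leqRHS](@big_cat_nat _ _ _ (n + k).+1)//=; last first.
  by rewrite ltnS leq_addr.
rewrite [X in (_ <= X + _)%N](@big_cat_nat _ _ _ k)//=; last first.
  by rewrite leqW// leq_addl.
apply: leq_trans (leq_addr _ _); apply: leq_trans (leq_addl _ _).
rewrite -[X in (_ <= \sum_(X <= _ < _) _)%N]add0n big_addn subSn ?leq_addl// addnK.
rewrite big_nat [leqRHS]big_nat; apply: leq_sum => i /andP[_ ni].
rewrite leq_mul2l (mulnC (b ^ _)%N) leq_mul2l.
suff -> : (n - i + l = n + k + l - (i + k))%N by rewrite leqnn !orbT.
lia.
Qed.

Lemma decaysM M M' k l f g : (0 < M)%N -> (0 < M')%N ->
  decays M k f -> decays M' l g -> decays (M + M') (k + l) (f * g).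
Proof.
move=> M0 M'0 [C fC] [C' gC].
exists (C * C' * (M + M')%:R ^+ (k + l)) => n.
have Cge0 := decays_coef_ge0 M0 fC; have C'ge0 := decays_coef_ge0 M'0 gC.
rewrite fpsM (le_trans (ler_norm_sum _ _ _))//.
have fact0 m : m`!%:R != 0 :> R by rewrite pnatr_eq0 -lt0n fact_gt0.
apply: (@le_trans _ _ (\sum_(i < n.+1) C * C' * ('C(n + k + l, i + k) *
    (M ^ (i + k) * M' ^ (n - i + l)))%N%:R / (n + k + l)`!%:R)).
  apply: ler_sum => i _; have iN : (i <= n)%N by rewrite -ltnS.
  rewrite normrM (le_trans (ler_pM _ _ (fC i) (gC (n - i)%N)))//.
  rewrite mulrACA -[leRHS]mulrA ler_wpM2l ?mulr_ge0//.
  have binE : 'C(n + k + l, i + k)%:R / (n + k + l)`!%:R =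
      ((i + k)`!%:R * (n - i + l)`!%:R)^-1 :> R.
    have le : (i + k <= n + k + l)%N by lia.
    rewrite -(bin_fact le) (_ : n + k + l - (i + k) = n - i + l)%N; last lia.
    rewrite !natrM; field; rewrite !fact0 pnatr_eq0 -lt0n bin_gt0 le//.
  rewrite natrM [leRHS]mulrAC binE /decay_bound natrM !natrX !exprD.
  have -> (a b d e : R) : a / d * (b / e) = (d * e)^-1 * (a * b).
    by rewrite invfM mulrACA mulrC.
  rewrite ler_wpM2l ?invr_ge0//.
  have M1 j : 1 <= M%:R ^+ j :> R by rewrite exprn_ege1// ler1n.
  have M'1 j : 1 <= M'%:R ^+ j :> R by rewrite exprn_ege1// ler1n.
  by rewrite ler_pM// ?exprn_ge0// ler_peMr// exprn_ge0.
rewrite -mulr_suml -mulr_sumr -!mulrA ler_wpM2l// ler_wpM2l//.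
rewrite -natr_sum /decay_bound mulrA -exprD -natrX -(addnA n k l).
rewrite ler_wpM2r ?invr_ge0// ler_nat (addnC (k + l)%N) (addnA n k l).
exact: sum_binom_shift.
Qed.

(** Passing from [1] to [2 ^ n] absorbs any polynomial in [n], hence any quotient
    of factorials with a bounded shift, thanks to
    ['C(n + l, l) <= 2 ^ (n + l)]. *)
Lemma decays_widen k l f : decays 1 k f -> decays 2 l f.
Proof.
move=> /(decays_le (leq0n k)) [C fC]; have C0 := decays_coef_ge0 (ltnSn 0) fC.
exists (C * (2 ^+ l * l`!%:R)) => n; apply: le_trans (fC n) _.
have fact_le : ((n + l)`! <= 2 ^ (n + l) * l`! * n`!)%N.
  rewrite -(bin_fact (leq_addl n l)) addnK mulnA leq_pmul2r ?fact_gt0//.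
  rewrite leq_pmul2r ?fact_gt0// -[2%N]/(1 + 1)%N expnDn.
  rewrite (bigD1 (Ordinal (leq_addl n l : (l < (n + l).+1)%N)))//= !exp1n !muln1.
  exact: leq_addr.
rewrite -mulrA ler_wpM2l// /decay_bound expr1n addn0 mul1r mulrA.
rewrite ler_pdivlMr ?ltr0n ?fact_gt0// ler_pdivrMl ?ltr0n ?fact_gt0//.
have -> : 2 ^+ l * l`!%:R * 2 ^+ n = (2 ^ (n + l) * l`!)%N%:R :> R.
  by rewrite mulrAC -exprD addnC natrM natrX.
by rewrite -natrM ler_nat mulnC.
Qed.

End decay.

(** * Values at 1 and division by [1 - z] *)
Section at1.
Context (R : realType).
Local Notation y := (1 - fpsX R).
Implicit Types (f g h : fps R) (c : R) (M k l n : nat).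

(** Since [(j + m)!] is at least [j! m!], the tail is at most its first term times
    an exponential series. *)
Lemma sum_bound_tail M k n N : (0 < M)%N ->
  \sum_(n.+1 <= m < N) decay_bound R M k m <=
  M%:R * expR M%:R * decay_bound R M k.+1 n.
Proof.
move=> M0; rewrite -[X in \sum_(X <= _ < _) _]add0n big_addn.
apply: (@le_trans _ _ (\sum_(0 <= j < N - n.+1)
    exp_coeff M%:R j * (M%:R * decay_bound R M k.+1 n))).
  apply: ler_sum => j _; rewrite /decay_bound /exp_coeff/= exprD exprS.
  have -> (a b d e d' : R) : a / d * (e * (b / d')) = a * (e * b) / (d * d').
    by rewrite -!mulrA; congr (_ * _); rewrite mulrCA invfM; congr (_ * _); ring.
  rewrite ler_wpM2l//.
  have fact_gt (m : nat) : 0 < m`!%:R :> R by rewrite ltr0n fact_gt0.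
  rewrite lef_pV2 ?posrE ?mulr_gt0// -natrM ler_nat.
  have le1 : (j <= j + n.+1 + k)%N by lia.
  rewrite -(bin_fact le1) (_ : j + n.+1 + k - j = n + k.+1)%N; last lia.
  by rewrite leq_pmull// bin_gt0.
rewrite -mulr_suml (mulrC M%:R (expR _)) -mulrA.
rewrite ler_wpM2r ?mulr_ge0 ?decay_bound_ge0//.
apply: (@nondecreasing_cvgn_le _ (series (exp_coeff M%:R))).
  by apply: nondecreasing_series => i _ _; rewrite exp_coeff_ge0.
exact: is_cvg_series_exp_coeff.
Qed.

(** The sum [c] of the coefficients is the value of [f] at [1], and the quotient
    of [f - c] by [1 - z] has as coefficients the tails of the sum, up to sign.
    This is how every division by [1 - z] gains one factor. *)
Lemma decays_tail M k f : (0 < M)%N -> decays M k f ->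
  exists c, exists2 f1, decays M k.+1 f1 & f = fps_const c + y * f1.
Proof.
move=> M0 [C fC]; have C0 := decays_coef_ge0 M0 fC.
have cvgf : cvgn (series f).
  apply: normed_cvg.
  apply: (@series_le_cvg _ _ (fun n => C * exp_coeff M%:R n)) => [n|n|n|].
  - exact: normr_ge0.
  - by rewrite mulr_ge0// exp_coeff_ge0.
  - apply: le_trans (fC n) _; rewrite ler_wpM2l// /decay_bound /exp_coeff/=.
    rewrite ler_wpM2l// lef_pV2 ?posrE ?ltr0n ?fact_gt0// ler_nat.
    by rewrite leq_fact ?leq_addr.
  - exact/is_cvg_seriesZ/is_cvg_series_exp_coeff.
pose c := limn (series f).
exists c; exists (fun n => series f n.+1 - c); last first.
  apply: fpsP => -[|n]; rewrite fpsD mulrBl mul1r fpsD fpsN ?fpsX0 ?fpsXS/fps_const/=.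
    by rewrite subr0 addrC subrK /series/= big_nat1.
  by rewrite add0r opprB addrA subrK seriesSB.
exists (C * (M%:R * expR M%:R)) => n; rewrite /= distrC.
have cvg_tail : `|series f N - series f n.+1| @[N --> \oo] --> `|c - series f n.+1|.
  by apply: cvg_norm; apply: cvgB; [exact: cvgf|exact: cvg_cst].
apply: (cvgr_to_le cvg_tail).
exists n.+1 => // N /= nN.
rewrite /series/= (@big_cat_nat _ _ _ n.+1 0 N)//= addrAC subrr add0r.
rewrite (le_trans (ler_norm_sum _ _ _))// -mulrA.
apply: le_trans (ler_wpM2l C0 (sum_bound_tail k n N M0)).
by rewrite mulr_sumr; apply: ler_sum => m _; exact: fC.
Qed.

(** The class used when only convergence at [1] matters; it contains the entire
    functions of exponential type that occur below. *)
Definition entire f := exists2 M, (0 < M)%N & decays M 0 f.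

Lemma decays_entire M k f : (0 < M)%N -> decays M k f -> entire f.
Proof. by move=> M0 df; exists M => //; apply: decays_le df. Qed.

Lemma decays_leM M M' k f : (0 < M)%N -> (M <= M')%N ->
  decays M k f -> decays M' k f.
Proof.
move=> M0 MM' [C fC]; exists C => n; apply: le_trans (fC n) _.
rewrite ler_wpM2l ?(decays_coef_ge0 M0 fC)// /decay_bound ler_wpM2r ?invr_ge0//.
by rewrite lerXn2r ?nnegrE// ler_nat.
Qed.

Lemma entireD f g : entire f -> entire g -> entire (f + g).
Proof.
move=> [M M0 df] [M' M'0 dg]; exists (M + M')%N; first by rewrite addn_gt0 M0.
by apply: decaysD; [apply: decays_leM df|apply: decays_leM dg] => //; lia.
Qed.

Lemma entireN f : entire f -> entire (- f).
Proof. by move=> [M M0 df]; exists M => //; apply: decaysN. Qed.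

Lemma entireM f g : entire f -> entire g -> entire (f * g).
Proof.
move=> [M M0 df] [M' M'0 dg]; exists (M + M')%N; first by rewrite addn_gt0 M0.
exact: (decaysM M0 M'0 df dg).
Qed.

Lemma entire_const c : entire (fps_const c).
Proof. by exists 1%N => //; apply: decays_const. Qed.

Lemma entireX : entire (fpsX R).
Proof. by exists 1%N => //; apply: decaysX. Qed.

Lemma entire_deriv f : entire f -> entire (fderiv f).
Proof.
move=> [M M0 [C fC]]; exists M => //; exists (C * M%:R) => n.
rewrite fderivE normrM ger0_norm//.
apply: le_trans (ler_wpM2l _ (fC n.+1)) _ => //.
rewrite /decay_bound !addn0 exprS factS natrM invfM.
have n0 : n.+1%:R != 0 :> R by rewrite pnatr_eq0.
have f0 : n`!%:R != 0 :> R by rewrite pnatr_eq0 -lt0n fact_gt0.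
rewrite le_eqVlt; apply/orP; left; apply/eqP.
move: n0 f0; move: (n.+1%:R : R) (n`!%:R : R) => a b a0 b0.
by field; rewrite ?a0 ?b0.
Qed.

(** The value of an entire series at [1], in the form that makes products and
    further divisions by [1 - z] algebraic: [f - c] is [1 - z] times an entire
    series. *)
Definition at1 f c := exists2 f1, entire f1 & f = fps_const c + y * f1.

Lemma at1D f g a b : at1 f a -> at1 g b -> at1 (f + g) (a + b).
Proof.
move=> [f1 ef ->] [g1 eg ->]; exists (f1 + g1); first exact: entireD.
by rewrite rmorphD/=; ring.
Qed.

Lemma at1N f a : at1 f a -> at1 (- f) (- a).
Proof.
move=> [f1 ef ->]; exists (- f1); first exact: entireN.
by rewrite rmorphN/=; ring.
Qed.

Lemma at1M f g a b : at1 f a -> at1 g b -> at1 (f * g) (a * b).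
Proof.
move=> [f1 ef ->] [g1 eg ->].
exists (fps_const a * g1 + fps_const b * f1 + y * f1 * g1).
  have ey : entire y by apply: entireD; [exact: entire_const|apply/entireN/entireX].
  by do 2?[apply: entireD]; do 2?[apply: entireM => //]; exact: entire_const.
by rewrite rmorphM/=; ring.
Qed.

Lemma at1_const c : at1 (fps_const c) c.
Proof.
exists 0; last by rewrite mulr0 addr0.
by rewrite -(rmorph0 (@fps_const R)); exact: entire_const.
Qed.

Lemma at1X : at1 (fpsX R) 1.
Proof. by exists (- 1); [exact/entireN/entire_const|rewrite rmorph1; ring]. Qed.

Lemma at1_y f : entire f -> at1 (y * f) 0.
Proof. by move=> ef; exists f => //; rewrite rmorph0 add0r. Qed.

Lemma entire_cvg f : entire f -> f @ \oo --> 0.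
Proof.
move=> [M M0 [C fC]]; apply/cvgr0Pnorm_le => e e0.
have : C * exp_coeff M%:R n @[n --> \oo] --> C * 0.
  by apply: cvgM; [exact: cvg_cst|exact: cvg_exp_coeff].
rewrite mulr0 => /cvgr0Pnorm_le /(_ e e0); apply: filterS => n.
apply: le_trans; rewrite [leRHS]ger0_norm.
  by rewrite (le_trans (fC n))// /decay_bound addn0.
by rewrite mulr_ge0 ?exp_coeff_ge0// (decays_coef_ge0 M0 fC).
Qed.

(** A nonzero constant divided by [1 - z] has constant coefficients, which do not
    tend to 0. *)
Lemma at1_uniq f a b : at1 f a -> at1 f b -> a = b.
Proof.
move=> fa fb; have := at1D fa (at1N fb).
rewrite subrr => -[g eg /esym/(canRL (addKr _))]; rewrite addr0 -rmorphN/=.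
set c := - (a - b) => gE.
suff /eqP : c = 0 by rewrite oppr_eq0 subr_eq0 => /eqP.
have geomg : geom R * fps_const c = g.
  by rewrite -gE mulrA [geom R * _]mulrC y_geom mul1r.
have gc n : g n = c by rewrite -geomg mulrC fps_constE mulr1.
have := entire_cvg eg; rewrite (_ : g = fun=> c); last exact/funext.
by move=> /(cvg_unique _ (cvg_cst _)); apply; exact: norm_hausdorff.
Qed.

(** The differential operator of the one-notched pieces, after multiplication of
    the unknown series by [1 - z]; its coefficient at [n] is
    [(2 n - 1) f_n + f_(n-1)]. *)
Definition outer_op f := 2 * fpsX R * fderiv f - f + fpsX R * f.

Lemma coef_outer_op f n : outer_op f n.+1 = (2 * n.+1)%:R * f n.+1 - f n.+1 + f n.
Proof.
rewrite /outer_op !fpsD fpsN fpsXS -mulrA mulr_natl fpsMn fpsXS fderivE.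
by rewrite natrM -mulrA [in LHS]mulr2n mulr2n mulrDl mul1r.
Qed.

(** A solution gains one factor over the right-hand side because of the
    coefficient [2 n - 1]; the term [f_(n-1)] consumes only half of what this
    coefficient offers, so the induction closes once [n] exceeds [k + 2]. *)
Lemma decays_outer_op M k f : (0 < M)%N -> decays M k (outer_op f) -> decays M k.+1 f.
Proof.
move=> M0 [C LC]; have C0 := decays_coef_ge0 M0 LC.
(* For [m >= k + 3] one has [m + k + 2 <= (2 k + 4) (m - k - 1)]. *)
pose N := k.+3.
have [C' C'C C'f] : exists2 C', (2 * k%:R + 4) * C <= C' &
    `|f N| <= C' * decay_bound R M k.+1 N.
  exists (Num.max ((2 * k%:R + 4) * C) (`|f N| / decay_bound R M k.+1 N)).
    by rewrite le_max lexx.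
  by rewrite -ler_pdivrMr ?decay_bound_gt0// le_max lexx orbT.
apply: (@decays_eventually _ _ _ N C') => // n /subnK <-.
elim: (n - N)%N => [//|i]; rewrite addSn; set m := (i + N)%N => IH.
have mk : k%:R + 3 <= m%:R :> R by rewrite -natrD ler_nat /m /N; lia.
have := coef_outer_op f m; have := LC m.+1.
have B0 := decay_bound_ge0 R M k m.+1.
have -> : decay_bound R M k.+1 m.+1 = decay_bound R M k m.+1 / (m%:R + k%:R + 2).
  rewrite /decay_bound -mulrA -invfM; congr (_ / _).
  by rewrite addnS factS natrM mulrC -natrD -natrD; congr (_ * _%:R); lia.
have Bm : decay_bound R M k.+1 m <= decay_bound R M k m.+1.
  rewrite /decay_bound addnS addSn ler_wpM2r// exprS ler_peMl ?exprn_ge0//.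
  by rewrite ler1n.
move: IH B0 Bm; move: (decay_bound R M k m.+1) (f m) (f m.+1) (outer_op f m.+1).
move=> B fm fm1 l IH B0 Bm lB lE.
have fm1E : (2 * m%:R + 1) * fm1 = l - fm.
  by rewrite lE natrM -natr1; ring.
have C'0 : 0 <= C' by apply: le_trans C'C; rewrite mulr_ge0// addr_ge0// mulr_ge0.
have k0 : 0 <= k%:R :> R by [].
have d0 : 0 < 2 * m%:R + 1 :> R by lra.
rewrite -(ler_pM2l d0) -[leLHS]ger0_norm ?mulr_ge0 ?(ltW d0)//.
rewrite normrM normr_id -normrM fm1E (le_trans (ler_normB _ _))//.
apply: (@le_trans _ _ ((C + C') * B)).
  by rewrite mulrDl lerD// (le_trans IH)// ler_wpM2l.
have e0 : 0 < m%:R + k%:R + 2 :> R by lra.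
have -> : (2 * m%:R + 1) * (C' * (B / (m%:R + k%:R + 2))) =
    (2 * m%:R + 1) * C' / (m%:R + k%:R + 2) * B.
  by rewrite !mulrA [RHS]mulrAC.
rewrite ler_wpM2r// ler_pdivlMr//.
have Cm : C * (m%:R + k%:R + 2) <= C * ((2 * k%:R + 4) * (m%:R - k%:R - 1)).
  by rewrite ler_wpM2l//; nra.
have C'm : (2 * k%:R + 4) * C * (m%:R - k%:R - 1) <= C' * (m%:R - k%:R - 1).
  by rewrite ler_wpM2r//; lra.
by rewrite -subr_ge0 in Cm C'm *; lra.
Qed.

End at1.

(** * Closed forms of the first and second moments *)
Section closed_forms.
Context (R : realType).
Implicit Types (f g h : fps R).

Local Notation z := (fpsX R).
Local Notation y := (1 - fpsX R).
Local Notation w := (geom R).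

Lemma at1_cvg f c : at1 f c -> series f @ \oo --> c.
Proof.
move=> [f1 ef1 ->].
rewrite -cvg_shiftS (_ : (fun n => _) = (fun n => c + f1 n)).
  have : (fun n => c + f1 n) @ \oo --> c + 0.
    by apply: cvgD; [exact: cvg_cst|exact: entire_cvg].
  by rewrite addr0.
set F := fps_const c + y * f1.
have FE n : F n = if n is m.+1 then f1 n - f1 m else c + f1 n.
  rewrite /F fpsD mulrBl mul1r fpsD fpsN; case: n => [|n].
    by rewrite fpsX0 subr0.
  by rewrite fpsXS /fps_const/= add0r.
apply/funext; elim=> [|n IH].
  by rewrite /series/= big_nat1 FE.
by rewrite -[LHS](subrK (series F n.+1)) seriesSB IH FE/=; ring.
Qed.

(** One quarter of [exp (- 1)], chosen so that the closed forms below have integer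
    coefficients; in particular [mu = 1 - 2 kap]. *)
Definition kap : R := expR (- 1) / 4.
Local Notation k := (fps_const kap).

Definition half_exp : fps R := fun n => (-1) ^+ n / n`!%:R / 2.
Local Notation e := half_exp.

Lemma fderiv_half_exp : fderiv e = - e.
Proof.
apply: fpsP => n; rewrite fderivE fpsN /e exprS factS natrM invfM.
have n0 : n.+1%:R != 0 :> R by rewrite pnatr_eq0.
have f0 : n`!%:R != 0 :> R by rewrite pnatr_eq0 -lt0n fact_gt0.
move: n0 f0; move: (n.+1%:R : R) (n`!%:R : R) => a b a0 b0.
by field; rewrite ?a0 ?b0.
Qed.

Lemma decays_half_exp : decays 1 0 e.
Proof.
exists 1 => n; rewrite /decay_bound addn0 expr1n /half_exp !normrM normrX normrN1.
rewrite expr1n mul1r !normfV !normr_nat ler_piMr// invf_le1//; lra.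
Qed.

(** The quotient of [2 kap - exp (- z) / 2], which vanishes at [1], by [1 - z];
    [tail2] repeats the operation. *)
Definition tail1 := (2 * k - e) * w.
Local Notation G := tail1.

Lemma y_tail1 : y * G = 2 * k - e.
Proof. by rewrite mulrC -mulrA [w * _]mulrC y_geom mulr1. Qed.

Lemma half_expE : e = 2 * k - y * G.
Proof. by rewrite y_tail1; ring. Qed.

Lemma decays_tail1 : decays 1 1 G.
Proof.
have [c [f df ef]] := decays_tail (ltn0Sn 0) decays_half_exp.
have ce : at1 e c by exists f => //; apply: decays_entire df.
have cE : c = 2 * kap.
  have /cvg_lim <-// := at1_cvg ce.
  apply: cvg_lim => //; rewrite (_ : series e =
    fun n => series (exp_coeff (-1)) n * 2^-1).
    rewrite (_ : 2 * kap = expR (-1) * 2^-1); last by rewrite /kap; field.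
    by apply: cvgM; [exact: is_cvg_series_exp_coeff|exact: cvg_cst].
  by apply/funext => n; rewrite /series/= mulr_suml.
suff -> : G = - f by exact: decaysN.
by apply: y_lreg; rewrite y_tail1 ef cE; ring.
Qed.

Lemma entire_tail1 : entire G. Proof. exact: decays_entire decays_tail1. Qed.

Let at1_nat n : at1 (n%:R : fps R) n%:R.
Proof. by rewrite -(rmorph_nat (@fps_const R)); exact: at1_const. Qed.

Let at1_k : at1 k kap. Proof. exact: at1_const. Qed.

Lemma at1_decays M j f : (0 < M)%N -> decays M j f -> exists c, at1 f c.
Proof.
move=> M0 /(decays_tail M0)[c [f1 df ->]]; exists c; exists f1 => //.
exact: decays_entire df.
Qed.

(** The value at [1] of the quotient is, up to sign, the derivative of the
    numerator at [1], and the derivative of [half_exp] is its opposite. *)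
Lemma at1_tail1 : at1 G (- (2 * kap)).
Proof.
have [d Gd] := at1_decays (ltn0Sn 0) decays_tail1.
suff GE : G = y * (G + fderiv G) - 2 * k.
  suff -> : - (2 * kap) = 0 - 2 * kap.
    rewrite GE; apply: at1D; last by apply/at1N/at1M.
    by apply/at1_y/entireD; [exact: entire_tail1|exact/entire_deriv/entire_tail1].
  by rewrite sub0r.
have := congr1 (@fderiv R) y_tail1; rewrite fderivM !raddfB/= fderiv1 fderivX.
rewrite fderivM fderiv_const -(rmorph_nat (@fps_const R)) fderiv_const.
rewrite fderiv_half_exp half_expE rmorph_nat => h.
apply/eqP; rewrite -subr_eq0 -oppr_eq0; apply/eqP.
move/eqP: h; rewrite -subr_eq0 => /eqP <-; ring.
Qed.

Definition tail2 := (G + 2 * k) * w.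
Local Notation g := tail2.

Lemma y_tail2 : y * g = G + 2 * k.
Proof. by rewrite mulrC -mulrA [w * _]mulrC y_geom mulr1. Qed.

Lemma tail1E : G = - (2 * k) + y * g.
Proof. by rewrite y_tail2; ring. Qed.

Lemma decays_tail2 : decays 1 2 g.
Proof.
have [c [f df ef]] := decays_tail (ltn0Sn 0) decays_tail1.
have ce : at1 G c by exists f => //; apply: decays_entire df.
have cE := at1_uniq ce at1_tail1.
suff -> : g = f by [].
by apply: y_lreg; rewrite y_tail2 ef cE; ring.
Qed.

Lemma fderiv_tail1 : fderiv G = g - G.
Proof.
apply: y_lreg; have := congr1 (@fderiv R) y_tail1.
rewrite fderivM !raddfB/= fderiv1 fderivX fderivM fderiv_const.
rewrite -(rmorph_nat (@fps_const R)) fderiv_const.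
rewrite fderiv_half_exp half_expE rmorph_nat mulrBr y_tail2 => h.
apply/eqP; rewrite -subr_eq0; apply/eqP.
move/eqP: h; rewrite -subr_eq0 => /eqP <-; ring.
Qed.

(** Certificates: the difference of the two sides of the goal is written as an
    explicit combination of known equations, and [ring] checks the combination.
    The equation used most is [(1 - z) w = 1], with [w = 1 / (1 - z)]. *)
Lemma lincomb (c A B l r : fps R) : l = r -> A - B = c * (l - r) -> A = B.
Proof. by move=> -> /eqP; rewrite subrr mulr0 subr_eq0 => /eqP. Qed.

Lemma lincomb2 (c d A B l r l' r' : fps R) : l = r -> l' = r' ->
  A - B = c * (l - r) + d * (l' - r') -> A = B.
Proof. by move=> -> -> /eqP; rewrite !subrr !mulr0 addr0 subr_eq0 => /eqP. Qed.

Lemma fderiv_tail2 : fderiv g = 2 * w * (g + k) - g.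
Proof.
have h := congr1 (@fderiv R) y_tail2.
rewrite fderivM !raddfB raddfD/= fderiv1 fderivX fderivM fderiv_const in h.
rewrite -(rmorph_nat (@fps_const R)) fderiv_const fderiv_tail1 rmorph_nat tail1E in h.
apply: y_lreg; apply: (lincomb2 (c := 1) (d := - 2 * (g + k)) h (y_geom R)); ring.
Qed.

Lemma at1_tail2 : at1 g (- kap).
Proof.
have [d gd] := at1_decays (ltn0Sn 0) decays_tail2.
have h : 2 * (g + k) = y * (fderiv g + g).
  by rewrite fderiv_tail2; apply: (lincomb (c := - 2 * (g + k)) (y_geom R)); ring.
have h1 : at1 (2 * (g + k)) (2 * (d + kap)) by apply: at1M => //; exact: at1D.
have h2 : at1 (2 * (g + k)) 0.
  rewrite h; apply/at1_y/entireD; last exact: decays_entire decays_tail2.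
  exact/entire_deriv/(decays_entire _ decays_tail2).
suff <- : d = - kap by [].
have := at1_uniq h1 h2; lra.
Qed.

(** The series of [(1 + z) / (2 (1 - z))], of total masses: the initial value
    [1 / 2] stands for a piece without columns between two notches, which counts
    only when the notches lie in opposite rows. *)
Definition inner_m0 : fps R := fun n => if n == 0%N then 2^-1 else 1.

Lemma inner_m0E : 2 * inner_m0 = 2 * w - 1.
Proof.
apply: fpsP => -[|n]; rewrite fpsD fpsN !mulr_natl !fpsMn fps1/= /inner_m0/geom/=.
  by rewrite [1 *+ 2]mulr2n addrK -mulr_natl mulfV// pnatr_eq0.
by rewrite mulr0n subr0.
Qed.

Let fderivD f h : fderiv (f + h) = fderiv f + fderiv h. Proof. exact: raddfD. Qed.
Let fderivN f : fderiv (- f) = - fderiv f. Proof. exact: raddfN. Qed.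

Let fderiv_nat n : fderiv (n%:R : fps R) = 0.
Proof. by rewrite -(rmorph_nat (@fps_const R)) fderiv_const. Qed.

Let fderiv_sqr f : fderiv (f ^+ 2) = 2 * f * fderiv f.
Proof. by rewrite expr2 fderivM; ring. Qed.

Let fderiv_simp := (fderiv_sqr, fderivD, fderivN, fderiv_nat, fderivM, fderiv_const,
  fderiv1, fderivX, @fderiv_geom R, fderiv_tail2, fderiv_tail1).

(** Series of the first and second moments of the two-notched pieces about their
    centres.  The second one has the double pole [12 kap^2 / (1 - z)^2], where
    [12 kap^2] is the asymptotic variance per column. *)
Definition inner_m1 := k + z * g.
Definition inner_m2_entire :=
  - 2 * k ^+ 2 * (4 * z + 5) - 8 * k * z * g + 2 * z * y * g ^+ 2
  - 4 * k * z ^+ 2 * g.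
Definition inner_m2 := 12 * k ^+ 2 * w ^+ 2 + inner_m2_entire.

Lemma inner_m1_ode : z * fderiv inner_m1 - inner_m1 =
    z * (2 * inner_m0 * inner_m1) - k * (1 + z).
Proof.
rewrite inner_m0E raddfD/= fderivM fderiv_const fderivX fderiv_tail2 /inner_m1.
by apply: (lincomb (c := - 2 * z * k) (y_geom R)); ring.
Qed.

Lemma inner_m2_ode : z * fderiv inner_m2 - inner_m2 =
  z * (2 * inner_m0 * inner_m2 + 2 * inner_m1 ^+ 2) - 2 * k ^+ 2 - 4 * k ^+ 2 * z.
Proof.
rewrite inner_m0E /inner_m2 /inner_m2_entire.
rewrite !fderiv_simp /inner_m1.
apply: (lincomb (c := 4 * z ^+ 2 * g ^+ 2 + 8 * z ^+ 2 * g * k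
  + 8 * z ^+ 2 * k ^+ 2 + 8 * z * k ^+ 2 - 12 * w * k ^+ 2 - 12 * k ^+ 2)
  (y_geom R)).
by move: (fps_const kap) (geom R) tail2 (fpsX R) => k w g z; ring.
Qed.

(** The double factorial [(2 n - 1)!!]. *)
Definition odd_fact n : nat := \prod_(i < n) (2 * i + 1)%N.

Lemma odd_factS n : odd_fact n.+1 = (odd_fact n * (2 * n + 1))%N.
Proof. by rewrite /odd_fact big_ord_recr. Qed.

Lemma fact_le_odd_fact n : (n`! <= odd_fact n)%N.
Proof.
elim: n => [|n IH]; first by rewrite /odd_fact big_ord0.
by rewrite odd_factS factS mulnC leq_mul//; lia.
Qed.

Lemma odd_fact_gt0 n : (0 < odd_fact n)%N.
Proof. exact: leq_trans (fact_gt0 n) (fact_le_odd_fact n). Qed.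

Definition inv_odd_fact : fps R :=
  fun n => if n is m.+1 then (odd_fact m.+1)%:R^-1 else 0.
Local Notation D := inv_odd_fact.

Lemma decays_inv_odd_fact : decays 1 0 D.
Proof.
exists 1 => -[|n]; rewrite mul1r; first by rewrite normr0 decay_bound_ge0.
rewrite /decay_bound addn0 expr1n mul1r ger0_norm ?invr_ge0//.
rewrite lef_pV2 ?posrE ?ltr0n ?odd_fact_gt0 ?fact_gt0// ler_nat.
exact: fact_le_odd_fact.
Qed.

Lemma inv_odd_fact_ode : 2 * z * fderiv D - D = z * D + z.
Proof.
apply: fpsP => -[|n].
  by rewrite fpsD fpsN -mulrA mulr_natl fpsMn !fpsD !fpsX0 /fpsX/= mul0rn subrr addr0.
rewrite fpsD fpsN -mulrA mulr_natl fpsMn fpsD !fpsXS fderivE /fpsX/= eqSS.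
have odd0 m : (odd_fact m)%:R != 0 :> R by rewrite pnatr_eq0 -lt0n odd_fact_gt0.
rewrite -mulrnAl -mulrnA -[X in _ - X]mul1r -mulrBl.
have -> : (n.+1 * 2)%:R - 1 = (2 * n + 1)%:R :> R.
  by apply/eqP; rewrite subr_eq natr1 eqr_nat; lia.
case: n => [|n]/=; first by rewrite odd_factS /odd_fact big_ord0 mulfV ?add0r.
have d0 : (2 * n.+1 + 1)%:R != 0 :> R by rewrite pnatr_eq0.
by rewrite addr0 odd_factS natrM invfM mulrCA mulfV ?mulr1.
Qed.

(** With [z = t^2] this is half of [t exp (- t^2 / 2)] times the integral of
    [exp (- s^2 / 2)] for [s] from 0 to [t]: the error function enters through the
    half-integer exponents of the equation of the one-notched pieces. *)
Definition gauss_series := e * D.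
Local Notation h := gauss_series.

Lemma gauss_series_ode : 2 * z * fderiv h - h + z * h = z * e.
Proof.
rewrite fderivM fderiv_half_exp.
by apply: (lincomb (c := e) inv_odd_fact_ode); rewrite /gauss_series; ring.
Qed.

(** The series of the moments of the one-notched pieces are [outer_dm1 / (1 - z)]
    and [outer_dm2 / (1 - z)]. *)
Definition outer_dm1 := h + z * G.
Definition outer_dm2 := 2 * h * (G - k * (1 + z)) +
  z * (4 * k ^+ 2 * (2 + z) * w - 2 * k * (3 + z) * G + 2 * G ^+ 2).

Lemma outer_dm1_ode : outer_op outer_dm1 = 2 * z * inner_m1.
Proof.
have H := gauss_series_ode; rewrite half_expE tail1E in H.
rewrite /outer_op /outer_dm1; move: gauss_series H => h' H.
rewrite !fderiv_simp /inner_m1 tail1E.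
apply: (lincomb (c := 1) H).
by move: h' (fderiv h') tail2 k z {H} => *; ring.
Qed.

Let gauss_series_coef0 : h 0%N = 0.
Proof. by rewrite /gauss_series fpsM big_ord1/= mulr0. Qed.

Lemma outer_dm1_coef0 : outer_dm1 0%N = 0.
Proof. by rewrite /outer_dm1 fpsD fpsX0 addr0. Qed.

Lemma outer_dm2_coef0 : outer_dm2 0%N = 0.
Proof.
rewrite /outer_dm2 fpsD fpsX0 addr0 -mulrA mulr_natl fpsMn fpsM big_ord1.
by rewrite gauss_series_coef0 mul0r mul0rn.
Qed.

Lemma outer_dm2_ode : outer_op outer_dm2 =
    2 * z * (2 * outer_dm1 * inner_m1 + inner_m2).
Proof.
have H := gauss_series_ode; rewrite half_expE tail1E in H.
rewrite /outer_op /outer_dm2 /outer_dm1; move: gauss_series H => h' H.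
rewrite !fderiv_simp /inner_m2 /inner_m2_entire /inner_m1 tail1E.
apply: (lincomb2 (c := 2 * (- (2 * k) + y * g - k * (1 + z)))
  (d := - 8 * z ^+ 2 * w * k ^+ 2 - 4 * z ^+ 2 * k ^+ 2
    - 24 * z * w * k ^+ 2 - 16 * z * k ^+ 2) H (y_geom R)).
by move: h' (fderiv h') tail2 (fps_const kap) (geom R) (fpsX R) {H} => *; ring.
Qed.

Lemma outer_m1_ode : 2 * z * fderiv (outer_dm1 * w) - outer_dm1 * w =
  z * (2 * (inner_m0 * (outer_dm1 * w)) + 2 * (w * inner_m1)).
Proof.
have H := outer_dm1_ode; rewrite /outer_op in H.
move: outer_dm1 inner_m1 H => m1 i1 H; rewrite mulrA inner_m0E !fderiv_simp.
apply: (lincomb (c := w) H).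
by move: m1 (fderiv m1) i1 (geom R) (fpsX R) {H} => *; ring.
Qed.

Lemma outer_m2_ode : 2 * z * fderiv (outer_dm2 * w) - outer_dm2 * w =
  z * (2 * (inner_m0 * (outer_dm2 * w)) + 4 * (outer_dm1 * w * inner_m1) +
    2 * (w * inner_m2)).
Proof.
have H := outer_dm2_ode; rewrite /outer_op in H.
move: outer_dm1 outer_dm2 inner_m2 inner_m1 H => m1 m2 i2 i1 H.
rewrite mulrA inner_m0E !fderiv_simp.
apply: (lincomb (c := w) H).
by move: m1 m2 (fderiv m2) i2 i1 (geom R) (fpsX R) {H} => *; ring.
Qed.

End closed_forms.

(** * Behaviour of the closed forms at 1 *)
Section expansions.
Context (R : realType).
Implicit Types (f g h : fps R).

Local Notation z := (fpsX R).
Local Notation y := (1 - fpsX R).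
Local Notation w := (geom R).
Local Notation kap := (kap R).
Local Notation k := (fps_const kap).
Local Notation e := (half_exp R).
Local Notation G := (tail1 R).
Local Notation g := (tail2 R).
Local Notation D := (inv_odd_fact R).

Lemma at1_eq f a b : at1 f a -> a = b -> at1 f b.
Proof. by move=> fa <-. Qed.

Lemma at1_nat n : at1 (n%:R : fps R) n%:R.
Proof. by rewrite -(rmorph_nat (@fps_const R)); exact: at1_const. Qed.

Lemma at1_sqr f a : at1 f a -> at1 (f ^+ 2) (a ^+ 2).
Proof. by move=> fa; rewrite !expr2; exact: at1M. Qed.

Lemma at1_1 : at1 (1 : fps R) 1. Proof. exact: (at1_nat 1). Qed.

Lemma at1_half_exp : at1 e (2 * kap).
Proof.
rewrite half_expE; apply: at1_eq.
  apply: at1D; first by apply: at1M; [exact: at1_nat|exact: at1_const].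
  exact/at1N/at1_y/entire_tail1.
by rewrite subr0.
Qed.

Ltac at1_tac := repeat first [eassumption | exact: at1_tail1 | exact: at1_tail2
  | exact: at1_half_exp | exact: at1X | exact: at1_const | exact: at1_1
  | apply: at1_nat | apply: at1_sqr | apply: at1D | apply: at1N | apply: at1M].

Lemma at1_inner_m1 : at1 (inner_m1 R) 0.
Proof. by apply: at1_eq; [rewrite /inner_m1; at1_tac|ring]. Qed.

Lemma at1_inner_m2_entire : at1 (inner_m2_entire R) (- 6 * kap ^+ 2).
Proof. by apply: at1_eq; [rewrite /inner_m2_entire; at1_tac|ring]. Qed.

Lemma at1_entire f c : at1 f c -> entire f.
Proof.
move=> [f1 ef ->]; apply: entireD; first exact: entire_const.
by apply: entireM => //; apply: entireD; [exact: entire_const|exact/entireN/entireX].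
Qed.

Lemma at1_deriv f c f1 : f = fps_const c + y * f1 -> fderiv f = y * fderiv f1 - f1.
Proof.
by move=> ->; rewrite raddfD/= fderiv_const fderivM raddfB/= fderiv1 fderivX; ring.
Qed.

(** At [1] the operator reduces to twice the derivative, which is the opposite of
    the value of [(f - c) / (1 - z)].  So a right-hand side that vanishes at [1]
    makes [f - c] vanish twice there. *)
Lemma at1_outer_op f c f1 d l :
  f = fps_const c + y * f1 -> at1 f1 d -> at1 (outer_op f) l -> l = - 2 * d.
Proof.
move=> fE f1d Ll; apply: (at1_uniq Ll).
have -> : outer_op f = 2 * z * (y * fderiv f1 - f1) - y * f.
  by rewrite /outer_op (at1_deriv fE); ring.
have ef : entire f.
  rewrite fE; apply: entireD; first exact: entire_const.
  apply: entireM (at1_entire f1d).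
  by apply: entireD; [exact: entire_const|exact/entireN/entireX].
apply: at1_eq.
  apply: at1D; last by apply/at1N/at1_y.
  apply: at1M; first by at1_tac.
  apply: at1D; first by apply/at1_y/entire_deriv/(at1_entire f1d).
  exact: at1N f1d.
by rewrite mulr1 sub0r subr0 mulrN mulNr.
Qed.

Lemma decays_inner_m1 : decays 1 1 (inner_m1 R).
Proof.
apply: decaysD; first exact: decays_const.
by apply: decaysXM => //; exact: decays_tail2.
Qed.

(** The closed form gives the value at [1]; the right-hand side [2 z inner_m1]
    vanishes at [1], hence the double zero of the remainder. *)
Lemma outer_dm1_expansion K : at1 D K ->
  exists2 q2, decays 1 3 q2 & outer_dm1 R =
    fps_const (2 * kap * (K - 1)) + y ^+ 2 * q2.
Proof.
move=> DK.
have q1K : at1 (outer_dm1 R) (2 * kap * (K - 1)).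
  by apply: at1_eq; [rewrite /outer_dm1/gauss_series; at1_tac|ring].
have dLq : decays 1 0 (outer_op (outer_dm1 R)).
  by rewrite outer_dm1_ode -mulrA; apply/decays_natM/decaysXM => //;
    exact: decays_inner_m1.
have [c [q1 dq1 qE]] := decays_tail (ltn0Sn 0) (decays_outer_op (ltn0Sn 0) dLq).
have cE : c = 2 * kap * (K - 1).
  by apply: at1_uniq q1K; exists q1 => //; exact: decays_entire dq1.
have [d [q2 dq2 q1E]] := decays_tail (ltn0Sn 0) dq1.
have q1d : at1 q1 d by exists q2 => //; exact: decays_entire dq2.
have Lq0 : at1 (outer_op (outer_dm1 R)) 0.
  rewrite outer_dm1_ode; apply: at1_eq.
    by apply: at1M; [at1_tac|exact: at1_inner_m1].
  by rewrite mulr0.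
have d0 : d = 0 by have := at1_outer_op qE q1d Lq0; lra.
exists q2 => //; rewrite qE cE q1E d0 rmorph0; ring.
Qed.

(** The value at [1] of [outer_dm2] deprived of its pole. *)
Definition outer_m2_const K := 20 * kap ^+ 2 - 16 * kap ^+ 2 * K.

(** Subtracting the pole and the constant leaves a series [U].  Bounding it by its
    closed form would lose factors through cancellations, so the closed form only
    serves to evaluate [U] at [1], while the decay comes from the equation. *)
Lemma outer_dm2_expansion K : at1 D K ->
  exists2 r, decays 2 4 r &
    outer_dm2 R = 12 * k ^+ 2 * z * w + fps_const (outer_m2_const K) + y ^+ 2 * r.
Proof.
move=> DK.
pose U := outer_dm2 R - 12 * k ^+ 2 * z * w - fps_const (outer_m2_const K).
have LU : outer_op U =
    2 * z * (2 * outer_dm1 R * inner_m1 R + inner_m2_entire R) + 12 * k ^+ 2 * z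
    + fps_const (outer_m2_const K) * y.
  have H := outer_dm2_ode R; rewrite /outer_op /inner_m2 in H; rewrite /outer_op /U.
  have -> : fderiv (outer_dm2 R - 12 * k ^+ 2 * z * w -
        fps_const (outer_m2_const K)) =
      fderiv (outer_dm2 R) - 12 * k ^+ 2 * (w + z * w ^+ 2).
    have -> : 12 * k ^+ 2 = fps_const (12 * kap ^+ 2) by ring.
    move: (outer_m2_const K) (12 * kap ^+ 2) => a b;
      rewrite !raddfB/= fderiv_const subr0.
    by rewrite -mulrA fderivM fderiv_const fderivM fderivX fderiv_geom; ring.
  apply: (lincomb2 (c := 1) (d := 12 * k ^+ 2 * (2 * z * w + z)) H (y_geom R)).
  move: (outer_dm2 R) (fderiv (outer_dm2 R)) (outer_dm1 R) (inner_m1 R)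
    (inner_m2_entire R) (fps_const kap)
    (fps_const (outer_m2_const K)) (geom R) (fpsX R) {H} => *; ring.
have U0 : at1 U 0.
  have -> : U = 2 * gauss_series R * (G - k * (1 + z)) +
      z * (- (4 * k ^+ 2) - 2 * k * (3 + z) * G + 2 * G ^+ 2)
      - fps_const (outer_m2_const K).
    rewrite /U /outer_dm2; apply: (lincomb (c := - 4 * k ^+ 2 * z) (y_geom R)).
    by move: (gauss_series R) (tail1 R) (fps_const kap)
      (fps_const (outer_m2_const K)) (geom R) (fpsX R) => *; ring.
  by apply: at1_eq; [rewrite /gauss_series; at1_tac|rewrite /outer_m2_const; ring].
have [q2 dq2 qE] := outer_dm1_expansion DK.
have dLU : decays 2 1 (outer_op U).
  rewrite LU; have dconst j c : decays 2 j (fps_const c) by exact: decays_const.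
  have dXM j f : decays 2 j.+1 f -> decays 2 j (z * f) by exact: decaysXM.
  have dwide j : decays 2 j g by exact: decays_widen (@decays_tail2 R).
  apply: decaysD; last first.
    apply: decays_constM; apply: decaysD; first exact: (dconst _ 1).
    exact/decaysN/decaysX.
  apply: decaysD; last first.
    by rewrite -mulrA; apply: decays_natM; rewrite expr2 -mulrA;
      do 2!apply: decays_constM; exact: decaysX.
  rewrite -mulrA; apply/decays_natM/dXM/decaysD.
    rewrite qE (_ : 2 * _ * _ = 2 * (fps_const (2 * kap * (K - 1)) * inner_m1 R
        + y ^+ 2 * q2 * inner_m1 R)); last by ring.
    apply/decays_natM/decaysD.
      by apply/decays_constM/(decays_widen _ decays_inner_m1).
    apply: (@decaysM _ 1 1 1 1) => //; last exact: decays_inner_m1.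
    by rewrite expr2 -mulrA; apply: decaysyM => //; exact: decaysyM.
  rewrite /inner_m2_entire !mulNr.
  apply: decaysB; first apply: decaysD; first apply: decaysB.
  - apply: decaysN; rewrite -mulrA expr2 -mulrA; apply: decays_natM.
    do 2!apply: decays_constM; apply: decaysD; last first.
      by rewrite -(rmorph_nat (@fps_const R)); exact: dconst.
    by apply: decays_natM; exact: decaysX.
  - by rewrite -!mulrA; apply/decays_natM/decays_constM/dXM.
  - rewrite -!mulrA; apply/decays_natM/dXM/decaysyM => //.
    rewrite expr2; apply: (@decaysM _ 1 1 2 2) => //; exact: decays_tail2.
  - by rewrite expr2 -!mulrA; apply/decays_natM/decays_constM/dXM/dXM.
have [c [r1 dr1 UE]] := decays_tail (ltn0Sn 1) (decays_outer_op (ltn0Sn 1) dLU).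
have c0 : c = 0.
  by apply: at1_uniq U0; exists r1 => //; exact: decays_entire dr1.
have [d [r dr r1E]] := decays_tail (ltn0Sn 1) dr1.
have r1d : at1 r1 d by exists r => //; exact: decays_entire dr.
have LU0 : at1 (outer_op U) 0.
  have q1K : at1 (outer_dm1 R) (2 * kap * (K - 1)).
    by apply: at1_eq; [rewrite /outer_dm1/gauss_series; at1_tac|ring].
  have e0 := at1_inner_m1; have ve := at1_inner_m2_entire.
  by rewrite LU; apply: at1_eq; [at1_tac|ring].
have d0 : d = 0 by have := at1_outer_op UE r1d LU0; lra.
exists r => //.
have -> : outer_dm2 R = U + 12 * k ^+ 2 * z * w + fps_const (outer_m2_const K)
    by rewrite /U; ring.
by rewrite UE c0 r1E d0 rmorph0; ring.
Qed.

End expansions.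

(** * The Gaussian integral as a sum of inverse double factorials *)
Section gauss.
Context (R : realType).
Local Notation mu := (@lebesgue_measure R).

Definition gauss (x : R) := expR (- (x ^+ 2 / 2)).

Lemma is_derive_gauss (x : R) : is_derive x 1 gauss (- x * gauss x).
Proof.
rewrite /gauss; apply: is_derive_eq.
by rewrite /= /GRing.scale/=; field.
Qed.

Lemma continuous_gauss : continuous gauss.
Proof. by move=> x; apply/differentiable_continuous/derivable1_diffP;
  have [] := is_derive_gauss x. Qed.

Definition gauss_sum n (x : R) :=
  \sum_(j < n) x ^+ (2 * j + 1) / (odd_fact j.+1)%:R * gauss x.

(** Each term contributes the difference of two consecutive monomials over double
    factorials, so the derivative telescopes; integrating over [[0, 1]] amounts to
    [n] integrations by parts. *)
Lemma is_derive_gauss_sum n (x : R) : is_derive x 1 (gauss_sum n)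
  (gauss x * (1 - x ^+ (2 * n) / (odd_fact n)%:R)).
Proof.
have odd0 m : (odd_fact m)%:R != 0 :> R by rewrite pnatr_eq0 -lt0n odd_fact_gt0.
elim: n => [|n IH].
  rewrite /gauss_sum /odd_fact big_ord0 muln0 expr0 invr1 mulr1 subrr mulr0.
  rewrite (_ : (fun _ => _) = cst 0); first exact: is_derive_cst.
  by apply/funext => t; rewrite big_ord0.
set c : R := (odd_fact n.+1)%:R^-1.
rewrite (_ : gauss_sum n.+1 =
    gauss_sum n + c \*: ((@id R) ^+ (2 * n).+1 * gauss)); last first.
  apply/funext => t; rewrite /gauss_sum big_ord_recr/= addn1; congr (_ + _).
  by rewrite fctE exprfctE mulrAC mulrC.
have Hg := is_derive_gauss x.
apply: is_derive_eq.
rewrite /= /GRing.scale/= /c odd_factS natrM exprfctE/=.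
have -> : (2 * n.+1 = (2 * n).+2)%N by lia.
rewrite !exprS addn1.
have d0 : (2 * n).+1%:R != 0 :> R by rewrite pnatr_eq0.
move: (odd0 n) d0; move: ((odd_fact n)%:R : R) ((2 * n).+1%:R : R) => a d a0 d0.
by field; rewrite ?a0 ?d0.
Qed.

Lemma cvg_inv_odd_fact : (odd_fact n)%:R^-1 @[n --> \oo] --> (0 : R).
Proof.
have := entire_cvg (decays_entire (ltn0Sn 0) (@decays_inv_odd_fact R)).
by rewrite -cvg_shiftS => cD; rewrite -cvg_shiftS.
Qed.

Lemma continuous_derivable_oo (F f : R -> R) (a b : R) :
  (forall x : R, is_derive x (1 : R) F (f x)) -> derivable_oo_LRcontinuous F a b.
Proof.
move=> dF; have cF : continuous F.
  by move=> x; apply/differentiable_continuous/derivable1_diffP; have [] := dF x.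
split; first by move=> x _; have [] := dF x.
- exact/cvg_at_right_filter/cF.
- exact/cvg_at_left_filter/cF.
Qed.

Lemma integral_gauss_sum n :
  (\int[mu]_(x in `[0%R, 1%R]) (gauss x * (1 - x ^+ (2 * n) / (odd_fact n)%:R))%:E =
   (gauss_sum n 1)%:E)%E.
Proof.
have dF := is_derive_gauss_sum n.
rewrite (@continuous_FTC2 _ _ (gauss_sum n))//.
- rewrite -EFinB /gauss_sum [X in _ - X]big1 ?subr0// => i _.
  by rewrite addn1 expr0n !mul0r.
- apply: continuous_subspaceT => x; apply: continuousM; first exact: continuous_gauss.
  apply: continuousB; first exact: cvg_cst.
  apply: continuousM; last exact: cvg_cst.
  exact: exprn_continuous.
- exact: (continuous_derivable_oo _ _ dF).
- by move=> x _; rewrite derive1E; have [_ ->] := dF x.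
Qed.

Definition gauss01 : \bar R := (\int[mu]_(x in `[0%R, 1%R]) (gauss x)%:E)%E.

Let measurable_gauss : measurable_fun `[0 : R, 1 : R]%classic (fun x => (gauss x)%:E).
Proof.
apply/measurable_EFinP; apply: measurable_funTS.
by apply: continuous_measurable_fun; exact: continuous_gauss.
Qed.

Let measurable_integrand n : measurable_fun `[0 : R, 1 : R]%classic
  (fun x => (gauss x * (1 - x ^+ (2 * n) / (odd_fact n)%:R))%:E).
Proof.
apply/measurable_EFinP; apply: measurable_funTS.
apply: continuous_measurable_fun => x.
apply: continuousM; first exact: continuous_gauss.
apply: continuousB; first exact: cvg_cst.
apply: continuousM; last exact: cvg_cst.
exact: exprn_continuous.
Qed.

Lemma gauss01_bounds n : ((gauss_sum n 1)%:E <= gauss01 <=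
  (gauss_sum n 1 + (odd_fact n)%:R^-1)%:E)%E.
Proof.
have odd_gt0 m : 0 < (odd_fact m)%:R :> R by rewrite ltr0n odd_fact_gt0.
have odd_ge1 m : 1 <= (odd_fact m)%:R :> R by rewrite ler1n odd_fact_gt0.
have frac (x : R) : `[0, 1]%classic x ->
    0 <= x ^+ (2 * n) / (odd_fact n)%:R <= (odd_fact n)%:R^-1.
  rewrite /= in_itv/= => /andP[x0 x1]; rewrite divr_ge0 ?exprn_ge0//=.
  by rewrite ler_piMl ?invr_ge0// exprn_ile1.
have fac1 : (odd_fact n)%:R^-1 <= 1 :> R by rewrite invf_le1.
rewrite -integral_gauss_sum; apply/andP; split.
  apply: ge0_le_integral => //= [x /frac/andP[f0 f1]||x /frac/andP[f0 f1]].
  - by rewrite lee_fin mulr_ge0 ?expR_ge0// subr_ge0 (le_trans f1).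
  - exact: measurable_integrand.
  - by rewrite lee_fin ler_piMr ?expR_ge0// gerBl.
have cst_int : (\int[mu]_(x in `[0%R, 1%R]) ((odd_fact n)%:R^-1)%:E =
    ((odd_fact n)%:R^-1)%:E)%E.
  by rewrite integral_cst//= lebesgue_measure_itv/= lte01 oppr0 adde0 mule1.
have igr_ge0 (x : R) : `[0, 1]%classic x ->
    (0 <= (gauss x * (1 - x ^+ (2 * n) / (odd_fact n)%:R))%:E)%E.
  move=> /frac/andP[f0 f1]; rewrite lee_fin mulr_ge0 ?expR_ge0// subr_ge0.
  exact: le_trans f1 fac1.
rewrite EFinD -cst_int -integral_gauss_sum -ge0_integralD//=; last first.
  exact: measurable_integrand.
apply: ge0_le_integral => //= [x _||x xI].
- by rewrite lee_fin expR_ge0.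
- by apply: emeasurable_funD => //; exact: measurable_integrand.
have /andP[f0 f1] := frac x xI.
rewrite -EFinD lee_fin mulrBr mulr1 -addrA lerDl addrC subr_ge0.
rewrite (le_trans _ f1)// ler_piMl// /gauss -expR0 ler_expR.
by rewrite oppr_le0 divr_ge0// sqr_ge0.
Qed.

Local Open Scope ereal_scope.

(** Half of the mass lies on the negative half-line, by symmetry. *)
Lemma normal_prob01 :
  normal_prob 0 1 `]-oo, 1%R] = (2^-1)%:E + (normal_peak 1)%:E * gauss01.
Proof.
have pdfE (x : R) : normal_pdf 0 1 x = (normal_peak 1 * gauss x)%R.
  rewrite normal_pdfE ?oner_eq0// -[LHS]/(normal_peak 1 * normal_fun 0 1 x)%R.
  by rewrite /normal_fun /gauss subr0 expr1n mulNr.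
have cpdf : continuous (normal_pdf (0 : R) 1).
  exact: continuous_normal_pdf (oner_neq0 R).
have mpdf : measurable_fun [set: R] (fun x => (normal_pdf (0 : R) 1 x)%:E).
  by apply/measurable_EFinP; exact: measurable_normal_pdf.
have half : normal_prob 0 1 `]-oo, 0%R] = (2^-1 : R)%:E.
  rewrite /normal_prob -[X in `]-oo, X]]oppr0.
  rewrite ge0_integration_by_substitutionNy; last 2 first.
  - exact: continuous_subspaceT.
  - by move=> x _; exact: normal_pdf_ge0.
  have even : normal_pdf (0 : R) 1 =1 normal_pdf 0 1 \o -%R.
    by move=> x; rewrite /= !pdfE /gauss sqrrN.
  have := ge0_symfun_integralT (normal_pdf_ge0 0 1) cpdf even.
  rewrite integral_normal_pdf.
  rewrite (_ : [set x | _] = `[0%R, +oo[%classic); last first.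
    by apply/seteqP; split => x/=; rewrite in_itv/= andbT.
  under [in X in _ -> X]eq_integral do rewrite -even.
  move=> E; transitivity ((2^-1 * 2)%:E * \int[mu]_(x in `[0%R, +oo[)
      (normal_pdf 0 1 x)%:E); first by rewrite mulVf ?pnatr_eq0// mul1e.
  by rewrite EFinM -muleA -E mule1.
rewrite (_ : `]-oo, 1%R]%classic = `]-oo, 0%R] `|` `]0%R, 1%R]); last first.
  apply/seteqP; split => x /=; rewrite !in_itv/=.
    by have [x0|x0] := leP x 0%R; [left|right].
  by move=> [x0|/andP[//]]; apply: le_trans x0 _.
rewrite /normal_prob ge0_integral_setU//=; last 3 first.
- exact: measurable_funTS mpdf.
- by move=> x _; rewrite lee_fin normal_pdf_ge0.
- rewrite disj_set2E; apply/eqP; rewrite -subset0 => x []/=.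
  by rewrite !in_itv/= => x0 /andP[]; rewrite ltNge x0.
rewrite -[X in X + _ = _]/(normal_prob 0 1 `]-oo, 0%R]) half; congr (_ + _).
rewrite integral_itv_obnd_cbnd; last exact: measurable_funTS mpdf.
rewrite /gauss01 -ge0_integralZl//=.
- by apply: eq_integral => x _; rewrite pdfE EFinM.
- by move=> x _; rewrite lee_fin expR_ge0.
- by rewrite lee_fin normal_peak_ge0.
Qed.

Local Close Scope ereal_scope.

(** The partial sums, multiplied by [exp (- 1 / 2)], differ from the Gaussian
    integral over [[0, 1]] by at most [1 / (2 n - 1)!!]. *)
Lemma at1_inv_odd_fact : at1 (inv_odd_fact R)
  (Num.sqrt (2 * pi * expR 1) * (2 * Phi 1 - 1) / 2).
Proof.
have [K [D1 dD1 DE]] := decays_tail (ltn0Sn 0) (@decays_inv_odd_fact R).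
have DK : at1 (inv_odd_fact R) K by exists D1 => //; exact: decays_entire dD1.
suff <- : K = Num.sqrt (2 * pi * expR 1) * (2 * Phi 1 - 1) / 2 by [].
have gauss1 : gauss 1 = expR (- 2^-1) by rewrite /gauss expr1n mul1r.
have sumE n : gauss_sum n 1 = series (inv_odd_fact R) n.+1 * expR (- 2^-1).
  rewrite /gauss_sum /series/= big_nat_recl// add0r -gauss1 -mulr_suml big_mkord.
  by congr (_ * _); apply: eq_bigr => i _; rewrite expr1n mul1r.
have fin01 : gauss01 \is a fin_num.
  have /andP[le1 le2] := gauss01_bounds 0.
  by rewrite fin_numElt (lt_le_trans _ le1) ?ltNyr// (le_lt_trans le2) ?ltry.
have cvg_sum : gauss_sum n 1 @[n --> \oo] --> K * expR (- 2^-1).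
  under eq_fun do rewrite sumE.
  apply: cvgM; last exact: cvg_cst.
  by rewrite (cvg_shiftS (series (inv_odd_fact R))); exact: at1_cvg.
have gauss01E : fine gauss01 = K * expR (- 2^-1).
  have cvg_sum' : gauss_sum n 1 @[n --> \oo] --> fine gauss01.
    have up : fine gauss01 - (odd_fact n)%:R^-1 @[n --> \oo] --> fine gauss01.
      rewrite -[X in _ --> X]subr0; apply: cvgB; first exact: cvg_cst.
      exact: cvg_inv_odd_fact.
    apply: (squeeze_cvgr _ up (cvg_cst _)); apply: nearW => n.
    have := gauss01_bounds n; rewrite -(fineK fin01) !lee_fin => /andP[-> le].
    by rewrite lerBlDr le.
  by apply: cvg_unique cvg_sum' cvg_sum.
have -> : Phi 1 = 2^-1 + normal_peak 1 * (K * expR (- 2^-1)) :> R.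
  by rewrite /Phi normal_prob01 -(fineK fin01) -EFinM -EFinD/= gauss01E.
have -> : normal_peak 1 = (Num.sqrt (2 * pi))^-1 :> R.
  by rewrite /normal_peak expr1n mul1r mulr_natl.
rewrite sqrtrM ?mulr_ge0 ?pi_ge0//.
have -> : Num.sqrt (expR 1) = expR 2^-1 :> R.
  by rewrite -powR12_sqrt ?expR_ge0// -expRM mul1r.
rewrite expRN.
have s0 : Num.sqrt (2 * pi) != 0 :> R by rewrite gt_eqF// sqrtr_gt0 mulr_gt0// pi_gt0.
have e0 : expR 2^-1 != 0 :> R by rewrite gt_eqF// expR_gt0.
move: s0 e0; move: (Num.sqrt _) (expR _) => s t s0 t0.
by field; rewrite ?s0 ?t0.
Qed.

End gauss.

(** * Generating function of the number of occupied seats *)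
Section law.
Context (R : realType).
Implicit Types (A B : {fset seat}) (w : run) (n : nat).

(** A finite list that carries the law of the runs when [n] is at least the number
    of seats; it turns expectations into finite sums. *)
Fixpoint runs n A : seq run :=
  if n is n'.+1 then
    [::] :: [seq s :: w | s <- enum_fset A, w <- runs n' (occupy A s)]
  else [:: [::]].

Lemma runs_uniq n A : uniq (runs n A).
Proof.
elim: n A => //= n IH A; apply/andP; split.
  by apply/negP => /allpairsPdep[s [w [_ _]]].
apply: allpairs_uniq_dep => //; first exact: fset_uniq.
by move=> [s v] [t w] _ _ /= [-> ->].
Qed.

Lemma run_pmf_runs n A w : (#|` A| <= n)%N -> w \notin runs n A ->
  run_pmf R A w = 0.
Proof.
elim: n A w => [|n IH] A [|s w] An /=; rewrite ?inE//=.
  by move: An; rewrite leqn0 cardfs_eq0 => /eqP ->; rewrite in_fset0.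
case: ifPn => // sA wA; rewrite IH ?mulr0//.
  by rewrite -ltnS (leq_trans (occupy_lt sA) An).
by apply: contra wA => wA; apply/allpairsPdep; exists s, w.
Qed.

Definition size_pgf n A : {poly R} :=
  \sum_(w <- runs n A) run_pmf R A w *: 'X^(size w).

Lemma size_pgf0 A : size_pgf 0 A = (A == fset0)%:R%:P.
Proof. by rewrite /size_pgf big_seq1/= expr0 alg_polyC. Qed.

Lemma size_pgfS n A : size_pgf n.+1 A = (A == fset0)%:R%:P +
  #|` A|%:R^-1 *: ('X * \sum_(s <- A) size_pgf n (occupy A s)).
Proof.
rewrite /size_pgf/= big_cons/= expr0 alg_polyC; congr (_ + _).
rewrite big_allpairs_dep/= mulr_sumr scaler_sumr big_seq [RHS]big_seq.
apply: eq_bigr => s sA; rewrite mulr_sumr scaler_sumr; apply: eq_bigr => w _.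
by rewrite sA exprS -scalerAr scalerA.
Qed.

Lemma size_pgf_stable n m A : (#|` A| <= n)%N -> (#|` A| <= m)%N ->
  size_pgf n A = size_pgf m A.
Proof.
have A0 B : (#|` B| <= 0)%N -> B = fset0.
  by rewrite leqn0 cardfs_eq0 => /eqP.
elim: n m A => [|n IH] [|m] A An Am //.
- by rewrite size_pgf0 size_pgfS (A0 A An) big_seq_fset0 mulr0 scaler0 addr0.
- by rewrite size_pgf0 size_pgfS (A0 A Am) big_seq_fset0 mulr0 scaler0 addr0.
rewrite !size_pgfS; congr (_ + _ *: (_ * _)).
rewrite big_seq [RHS]big_seq; apply: eq_bigr => s sA.
by apply: IH; rewrite -ltnS (leq_trans (occupy_lt sA)).
Qed.

(** The probability generating function of the number of occupied seats. *)
Definition pgf A := size_pgf #|` A| A.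

Lemma pgf_fset0 : pgf fset0 = 1.
Proof. by rewrite /pgf cardfs0 size_pgf0 eqxx. Qed.

Lemma pgf_rec A : #|` A|%:R *: pgf A = 'X * \sum_(s <- A) pgf (occupy A s).
Proof.
have [->|A0] := eqVneq A fset0.
  by rewrite cardfs0 scale0r big_seq_fset0 mulr0.
have cA : #|` A|%:R != 0 :> R by rewrite pnatr_eq0 cardfs_eq0.
rewrite /pgf (@size_pgf_stable _ (#|` A|).+1)// size_pgfS (negbTE A0) add0r.
rewrite scalerA mulfV// scale1r; congr (_ * _).
rewrite big_seq [RHS]big_seq; apply: eq_bigr => s sA.
by apply: size_pgf_stable => //; exact/ltnW/occupy_lt.
Qed.

Lemma pgf1 A : (pgf A).[1] = 1.
Proof.
have [n] := ubnP #|` A|; elim: n A => // n IH A; rewrite ltnS => An.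
have [->|A0] := eqVneq A fset0; first by rewrite pgf_fset0 hornerC.
have cA : #|` A|%:R != 0 :> R by rewrite pnatr_eq0 cardfs_eq0.
apply: (mulfI cA); rewrite -hornerZ pgf_rec hornerM hornerX mul1r horner_sum.
rewrite big_seq (eq_bigr (fun=> 1)); last first.
  by move=> s sA; rewrite IH// (leq_trans (occupy_lt sA)).
by rewrite -big_seq big_tnth sumr_const card_ord mulr1.
Qed.

Lemma seating_lawE A (U : set run) : seating_law R A U =
  (\sum_(w <- runs #|` A| A) (run_pmf R A w)%:E * \d_w U)%E.
Proof.
rewrite /seating_law.
transitivity (\esum_(w in [set` runs #|` A| A]) ((run_pmf R A w)%:E * \d_w U))%E.
  rewrite esum_mkcond [RHS]esum_mkcond; apply: eq_esum => w _.
  rewrite diracE mem_setE.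
  have [wA|/(run_pmf_runs (leqnn _))->] := boolP (w \in runs _ A).
    by case: (w \in U); rewrite ?mule1 ?mule0.
  by case: (w \in U).
rewrite esum_fset; last 2 first.
- exact: finite_seq.
- by move=> w _; rewrite mule_ge0 ?lee_fin ?run_pmf_ge0.
by rewrite -fsbig_seq ?runs_uniq.
Qed.

Lemma ge0_integral_seating_law A (f : run -> R) : (forall w, 0 <= f w) ->
  (\int[seating_law R A]_w (f w)%:E =
    (\sum_(w <- runs #|` A| A) run_pmf R A w * f w)%:E)%E.
Proof.
move=> f0; set rs := runs _ A.
pose m i : {measure set run -> \bar R} :=
  mscale (NngNum (run_pmf_ge0 R A (nth ([::] : run) rs i)))
      \d_(nth ([::] : run) rs i : run).
rewrite (eq_measure_integral (msum m (size rs))); last first.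
  move=> U mU _; apply: etrans (seating_lawE A U) _.
  by rewrite (big_nth [::]) big_mkord /msum; apply: eq_bigr => i _.
rewrite ge0_integral_measure_sum//; last by move=> w _; rewrite lee_fin.
rewrite -sumEFin (big_nth [::]) big_mkord; apply: eq_bigr => i _.
rewrite ge0_integral_mscale//; last by move=> w _; rewrite lee_fin.
by rewrite integral_dirac// diracT mul1e.
Qed.

Lemma expectation_occupied A :
  ('E_(seating_law R A)[occupied R] = ((pgf A)^`().[1])%:E)%E.
Proof.
rewrite unlock ge0_integral_seating_law; last by move=> w; rewrite /occupied.
congr EFin; rewrite /pgf /size_pgf raddf_sum/= horner_sum.
apply: eq_bigr => w _; rewrite derivZ hornerZ derivXn hornerMn hornerXn.
by rewrite expr1n.
Qed.

Lemma expectation_occupied_sqr A :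
  ('E_(seating_law R A)[(occupied R ^+ 2)%R] =
    ((pgf A)^`()^`().[1] + (pgf A)^`().[1])%:E)%E.
Proof.
rewrite unlock.
rewrite (ge0_integral_seating_law _ (f := fun w => (size w)%:R ^+ 2)); last first.
  by move=> w; rewrite sqr_ge0.
congr EFin; rewrite /pgf /size_pgf !raddf_sum/= !horner_sum -big_split/=.
apply: eq_bigr => w _; rewrite !derivZ !hornerZ -mulrDr; congr (_ * _).
rewrite derivXn derivMn derivXn !hornerMn !hornerXn !expr1n.
by case: (size w) => [|n]/=; rewrite ?mulr0n ?expr0n ?addr0// -mulrnA -natrD
  -natrX; congr _%:R; lia.
Qed.

Lemma variance_occupied A :
  ('V_(seating_law R A)[occupied R] =
    ((pgf A)^`()^`().[1] + (pgf A)^`().[1] - (pgf A)^`().[1] ^+ 2)%:E)%E.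
Proof.
have L2 : occupied R \in Lfun (seating_law R A) 2%:E.
  rewrite inE; apply/andP; split; rewrite inE//=.
  rewrite /finite_norm unlock /= poweR_lty//.
  under eq_integral do rewrite powR_mulrn// -normrX ger0_norm ?sqr_ge0//.
  by rewrite (ge0_integral_seating_law _ (f := fun w => (size w)%:R ^+ 2)) ?ltry.
by rewrite varianceE// expectation_occupied_sqr expectation_occupied.
Qed.
End law.

(** * Pieces of the ladder *)
Section shapes.
Local Open Scope fset_scope.
Local Open Scope ring_scope.
Context (R : realType).
Implicit Types (A B C : {fset seat}) (s t : seat) (n : nat) (a b : option bool)
  (l : int).

Lemma neighborC s t : neighbor s t = neighbor t s.
Proof.
rewrite /neighbor ![t.1 == _]eq_sym ![t.2 == s.2]eq_sym.
by congr (_ && _ || _); rewrite orbC.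
Qed.

Lemma in_occupy A s t :
  (t \in occupy A s) = [&& t \in A, t != s & ~~ neighbor s t].
Proof. by rewrite !inE. Qed.

(** Independence of two configurations without neighbors across: the choices made
    in one leave the availability in the other unchanged, and the interleaving of
    the two processes does not affect the number of occupied seats. *)
Lemma pgf_disjoint B C : [disjoint B & C] ->
  (forall s t, s \in B -> t \in C -> ~~ neighbor s t) ->
  pgf R (B `|` C) = pgf R B * pgf R C.
Proof.
have [n] := ubnP (#|` B| + #|` C|)%N; elim: n B C => // n IH B C.
rewrite ltnS => BCn dBC nBC.
have cBC : #|` B `|` C| = (#|` B| + #|` C|)%N.
  by rewrite cardfsU; move: (dBC); rewrite -fsetI_eq0 => /eqP->;
    rewrite cardfs0 subn0.
have [BC0|BC0] := eqVneq (#|` B| + #|` C|)%N 0.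
  have [-> ->] : B = fset0 /\ C = fset0.
    by split; apply/eqP; rewrite -cardfs_eq0; move/eqP: BC0;
      rewrite addn_eq0 => /andP[].
  by rewrite fsetU0 !pgf_fset0 mulr1.
have c0 : (#|` B| + #|` C|)%:R != 0 :> R by rewrite pnatr_eq0.
apply: (scalerI c0); rewrite -{1}cBC pgf_rec.
have BCperm : perm_eq (enum_fset (B `|` C)) (enum_fset B ++ enum_fset C).
  apply: uniq_perm; rewrite ?fset_uniq//; last by move=> t; rewrite inE mem_cat.
  rewrite cat_uniq !fset_uniq/= andbT; apply/hasPn => t tC /=; apply/negP => tB.
  by move/fdisjointP: dBC => /(_ t tB); rewrite tC.
rewrite (perm_big _ BCperm) big_cat/=.
have -> : \sum_(s <- B) pgf R (occupy (B `|` C) s) =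
    \sum_(s <- B) pgf R (occupy B s) * pgf R C.
  rewrite big_seq [RHS]big_seq; apply: eq_bigr => s sB.
  have -> : occupy (B `|` C) s = occupy B s `|` C.
    apply/fsetP => t; rewrite !(in_occupy, inE).
    have [tC|tC] := boolP (t \in C); last by rewrite !orbF.
    rewrite !orbT/= nBC// andbT; apply/eqP => ts.
    by move/fdisjointP: dBC => /(_ s sB); rewrite -ts tC.
  apply: IH.
  - by rewrite (leq_trans _ BCn)// ltn_add2r occupy_lt.
  - apply/fdisjointP => t; rewrite in_occupy => /andP[tB _].
    by move/fdisjointP: dBC; exact.
  - by move=> t t'; rewrite in_occupy => /andP[tB _]; exact: nBC.
have -> : \sum_(s <- C) pgf R (occupy (B `|` C) s) =
    \sum_(s <- C) pgf R B * pgf R (occupy C s).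
  rewrite big_seq [RHS]big_seq; apply: eq_bigr => s sC.
  have -> : occupy (B `|` C) s = B `|` occupy C s.
    apply/fsetP => t; rewrite !(in_occupy, inE).
    have [tB|tB] := boolP (t \in B); last by rewrite !orFb.
    rewrite neighborC nBC// andbT; apply/eqP => ts.
    by move/fdisjointP: dBC => /(_ t tB); rewrite ts sC.
  apply: IH.
  - by rewrite (leq_trans _ BCn)// ltn_add2l occupy_lt.
  - apply/fdisjointP => t tB; rewrite in_occupy; apply/negP => /andP[tC _].
    by move/fdisjointP: dBC => /(_ t tB); rewrite tC.
  - by move=> t t' tB; rewrite in_occupy => /andP[tC _]; exact: nBC.
rewrite -mulr_suml -mulr_sumr mulrDr mulrA -pgf_rec mulrCA -pgf_rec.
by rewrite -scalerAl -scalerAr -scalerDl -natrD.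
Qed.

Lemma pgf_imfset (f : seat -> seat) A : injective f ->
  (forall s t, neighbor (f s) (f t) = neighbor s t) ->
  pgf R (f @` A) = pgf R A.
Proof.
move=> finj fN; have [n] := ubnP #|` A|; elim: n A => // n IH A; rewrite ltnS => An.
have cA : #|` f @` A| = #|` A| by rewrite card_imfset.
have [->|A0] := eqVneq A fset0; first by rewrite imfset0.
have c0 : #|` A|%:R != 0 :> R by rewrite pnatr_eq0 cardfs_eq0.
apply: (scalerI c0); rewrite -{1}cA !pgf_rec; congr (_ * _).
rewrite big_imfset/=; last by move=> ? ? _ _; exact: finj.
rewrite big_seq [RHS]big_seq; apply: eq_bigr => s sA.
rewrite -[RHS]IH; last by rewrite (leq_trans (occupy_lt sA)).
congr pgf; apply/fsetP => t; rewrite in_occupy.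
apply/and3P/imfsetP => [[/imfsetP[t' /= tA ->]]|[t' /=]].
  by rewrite fN (inj_eq finj) => ts ns; exists t' => //=; rewrite in_occupy tA ts.
rewrite in_occupy => /and3P[tA ts ns] ->; split.
- by apply/imfsetP; exists t'.
- by rewrite (inj_eq finj).
- by rewrite fN.
Qed.

Definition cells l n : seq seat :=
  [seq (r, l + k%:Z) | r <- [:: true; false], k <- iota 0 n].

Lemma in_cells l n s : (s \in cells l n) = (l <= s.2 < l + n%:Z).
Proof.
apply/allpairsP/andP => [[[r k] /= [_ kn ->]]|[ls sl]] /=.
  by rewrite mem_iota in kn; split; lia.
exists (s.1, `|s.2 - l|%N) => /=; split.
- by case: s.1.
- by rewrite mem_iota; lia.
- by case: s ls sl => r i /= *; congr pair; lia.
Qed.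

(** The [n] columns starting at [l], without the seat of the first column in the
    row prescribed by [a] and the seat of the last column in the row prescribed by
    [b], if any; when [n] is 1 both seats may be missing from the only column. *)
Definition shape l n a b : {fset seat} :=
  [fset s in cells l n | ~~ ((a == Some s.1) && (s.2 == l)) &&
     ~~ ((b == Some s.1) && (s.2 + 1 == l + n%:Z))].

Lemma in_shape l n a b s : (s \in shape l n a b) =
  [&& l <= s.2, s.2 < l + n%:Z, ~~ ((a == Some s.1) && (s.2 == l)) &
     ~~ ((b == Some s.1) && (s.2 + 1 == l + n%:Z))].
Proof.
by rewrite !inE/= in_cells -andbA.
Qed.

Lemma big_shape (V : nmodType) (F : seat -> V) l n a b :
  \sum_(s <- shape l n a b) F s = \sum_(r : bool) \sum_(k < n)
    (if (r, l + k%:Z) \in shape l n a b then F (r, l + k%:Z) else 0).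
Proof.
pose S := cells l n.
have Sp : perm_eq (enum_fset (shape l n a b)) [seq s <- S | s \in shape l n a b].
  apply: uniq_perm; first exact: fset_uniq.
    apply/filter_uniq/allpairs_uniq => //; first exact: iota_uniq.
    by move=> [r k] [r' k'] _ _ /= [-> /addrI [->]].
  move=> s; rewrite mem_filter; case: (boolP (s \in shape l n a b)) => //=.
  by rewrite !inE => /andP[].
rewrite (perm_big _ Sp) big_filter big_mkcond /S /cells big_allpairs_dep.
rewrite big_cons big_seq1 big_bool/=.
have iotaE r : \sum_(k <- iota 0 n)
      (if (r, l + k%:Z) \in shape l n a b then F (r, l + k%:Z) else 0) =
    \sum_(k < n) (if (r, l + k%:Z) \in shape l n a b then F (r, l + k%:Z) else 0).
  by rewrite -(big_mkord xpredT (fun k =>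
    if (r, l + k%:Z) \in shape l n a b then F (r, l + k%:Z) else 0))
    /index_iota subn0.
by rewrite !iotaE.
Qed.

(** The occupied seat notches both remaining pieces in its own row.  The statement
    is uniform: it covers seats in the end columns, whose pieces may be empty. *)
Lemma occupy_shape l n a b r k : (k < n)%N -> (r, l + k%:Z) \in shape l n a b ->
  occupy (shape l n a b) (r, l + k%:Z) =
  shape l k a (Some r) `|` shape (l + k.+1%:Z) (n.-1 - k) (Some r) b.
Proof.
move=> kn; rewrite in_shape/= => sS; apply/fsetP => -[r' i].
rewrite in_occupy in_fsetU !in_shape/= /neighbor/= xpair_eqE.
rewrite !(inj_eq Some_inj) (eq_sym r').
move: (a == Some r') (b == Some r') (r == r') => x y e.
have nk : l + k.+1%:Z + (n.-1 - k)%N%:Z = l + n%:Z by lia.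
rewrite nk.
(* Left of the occupied column, right of it, and in it. *)
have [ilk|ilk|ilk] := ltgtP i (l + k%:Z).
- have -> : (l + k.+1%:Z <= i) = false by lia.
  have -> : (i + 1 == l + n%:Z) = false by lia.
  have -> : (i == l + k%:Z + 1) = false by lia.
  have -> : (i < l + n%:Z) = true by lia.
  rewrite (_ : (l + k%:Z == i + 1) = (i + 1 == l + k%:Z)); last by rewrite eq_sym.
  by case: x y e => [] [] [] /=; rewrite -?andbA ?andbT ?andbF ?orbF ?orbT.
- have -> : (l + k.+1%:Z <= i) = true by lia.
  have -> : (l <= i) = true by lia.
  have -> : (i == l) = false by lia.
  have -> : (l + k%:Z == i + 1) = false by lia.
  rewrite (_ : (i == l + k.+1%:Z) = (i == l + k%:Z + 1)); last by congr (_ == _); lia.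
  by move: (i < _) (i + 1 == _) (i == _) => p q r'' ;
    case: x y e p q r'' => [] [] [] [] [] [].
- have -> : (l + k.+1%:Z <= i) = false by lia.
  by case: x y e => [] [] [] /=; rewrite ?eqxx ?andbT ?andbF ?orbF ?orbT.
Qed.

(** The generating function of a piece, except that it is 0 when [n] is 0 and both
    notches are in the same row.  Such an empty piece would arise from occupying a
    seat that is missing, so with this convention the sums below can run over all
    seats of the [n] columns. *)
Definition notched_pgf n a b : {poly R} :=
  if (n == 0%N) && (a == b) && (a != None) then 0 else pgf R (shape 0 n a b).

End shapes.

(** * Recurrences between generating functions *)
Section shape_recurrence.
Local Open Scope fset_scope.
Local Open Scope ring_scope.
Context (R : realType).
Implicit Types (A B C : {fset seat}) (s t : seat) (n : nat) (a b : option bool)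
  (l : int).
Local Notation notched_pgf := (notched_pgf R).

Lemma in_imfset_can (f g : seat -> seat) A t : cancel f g -> cancel g f ->
  (t \in f @` A) = (g t \in A).
Proof.
move=> fK gK; apply/imfsetP/idP => [[s /= sA ->]|gtA]; first by rewrite fK.
by exists (g t).
Qed.

Lemma pgf_shape_translate l n a b : pgf R (shape l n a b) = pgf R (shape 0 n a b).
Proof.
pose f (s : seat) : seat := (s.1, s.2 + l).
pose g (s : seat) : seat := (s.1, s.2 - l).
have fK : cancel f g by move=> [r i]; rewrite /f /g/= addrK.
have gK : cancel g f by move=> [r i]; rewrite /f /g/= subrK.
rewrite -(pgf_imfset R (shape 0 n a b) (can_inj fK)); last first.
  move=> [r i] [r' i']; rewrite /neighbor/= !(addrAC _ l 1).
  by rewrite !(inj_eq (addIr l)).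
congr pgf; apply/fsetP => -[r i]; rewrite (in_imfset_can _ _ fK gK) !in_shape/=.
by congr [&& _, _, ~~ (_ && _) & ~~ (_ && _)]; lia.
Qed.

Lemma pgf_shape_mirror l n a b : pgf R (shape l n a b) = pgf R (shape 0 n b a).
Proof.
pose f (s : seat) : seat := (s.1, - s.2).
have fK : cancel f f by move=> [r i]; rewrite /f/= opprK.
rewrite -(pgf_imfset R (shape l n a b) (can_inj fK)); last first.
  move=> [r i] [r' i']; rewrite /neighbor/=; congr (_ && _ || _ && _); lia.
rewrite -(pgf_shape_translate (1 - l - n%:Z)).
congr pgf; apply/fsetP => -[r i]; rewrite (in_imfset_can _ _ fK fK) !in_shape/=.
rewrite andbCA; congr [&& _, _ & _]; [lia|lia|].
by rewrite andbC; congr (~~ (_ && _) && ~~ (_ && _)); lia.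
Qed.

Lemma pgf_shape_flip l n a b :
  pgf R (shape l n (omap negb a) (omap negb b)) = pgf R (shape l n a b).
Proof.
pose f (s : seat) : seat := (~~ s.1, s.2).
have fK : cancel f f by move=> [r i]; rewrite /f/= negbK.
rewrite -(pgf_imfset R (shape l n a b) (can_inj fK)); last first.
  by move=> [[] i] [[] i']; rewrite /neighbor.
congr pgf; apply/fsetP => -[r i]; rewrite (in_imfset_can _ _ fK fK) !in_shape/=.
by case: a b r => [[]|] [[]|] [].
Qed.

(** A missing seat contributes 0 to the sum, by the convention made for
    [notched_pgf]. *)
Lemma pgf_shape_rec l n a b :
  #|` shape l n a b|%:R *: pgf R (shape l n a b) =
  'X * \sum_(r : bool) \sum_(k < n)
    notched_pgf k a (Some r) * notched_pgf (n.-1 - k) (Some r) b.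
Proof.
rewrite pgf_rec big_shape; congr (_ * _); apply: eq_bigr => r _.
apply: eq_bigr => k _; have kn := ltn_ord k.
case: ifPn => [sS|].
  rewrite occupy_shape// pgf_disjoint.
  - rewrite (pgf_shape_translate l) (pgf_shape_translate (l + _)) /notched_pgf.
    move: sS; rewrite in_shape/= => /and4P[_ _ ha hb].
    rewrite ifF; last first.
      apply/negP => /andP[/andP[/eqP k0 ar] _]; move: ha; rewrite k0 ar/= addr0.
      by rewrite eqxx.
    rewrite ifF//.
    apply/negP => /andP[/andP[/eqP k0 ar] _]; move: hb; rewrite eq_sym ar/=.
    by apply/negP; rewrite negbK; lia.
  - apply/fdisjointP => -[r' i]; rewrite !in_shape/= => /and3P[_ ? _].
    by apply/negP => /and3P[]; lia.
  - move=> [r' i] [r'' i']; rewrite !in_shape/=.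
    move=> /and4P[_ ik _ h1] /and4P[ki _ h2 _].
    rewrite /neighbor/=; apply/negP => /orP[/andP[/eqP rr]|/andP[_]]; last by lia.
    move: h1 h2; rewrite rr; case: (Some r == Some r'') => /=; lia.
rewrite in_shape/= 3!negb_and !negbK => /or4P[||/andP[/eqP ar k0]|/andP[/eqP br k0]].
- by lia.
- by lia.
- by rewrite {1}/notched_pgf ar eqxx (_ : nat_of_ord k == 0%N)/= ?mul0r//; lia.
- by rewrite {2}/notched_pgf br eqxx (_ : (n.-1 - k == 0)%N)/= ?mulr0//; lia.
Qed.

Lemma count_notched n (x y : bool) : (0 < n)%N -> ~~ [&& n == 1%N, x & y] ->
  (\sum_(k < n) (~~ (x && (k == 0 :> nat)) && ~~ (y && (k.+1 == n))) + x + y = n)%N.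
Proof.
case: n => [//|[|n]] _ /=.
  by rewrite big_ord1; case: x y => [] [].
move=> _; rewrite big_ord_recl big_ord_recr/= (eq_bigr (fun=> 1%N)); last first.
  by move=> i _; rewrite /bump/= add1n !eqSS (ltn_eqF (ltn_ord i)) !andbF.
by rewrite sum1_card card_ord /bump/= add1n eqxx !andbF !andbT/=;
  case: x y => [] []/=; lia.
Qed.

Lemma card_shape n a b : (0 < n)%N -> [|| (1 < n)%N, a == None | b == None] ->
  #|` shape 0 n a b| = (2 * n - (a != None) - (b != None))%N.
Proof.
move=> n0 nab.
have -> : #|` shape 0 n a b| = (\sum_(s <- shape 0 n a b) 1)%N.
  by rewrite big_tnth sum1_card card_ord.
rewrite (big_shape (fun=> 1%N)) big_bool/=.
have rowE (r : bool) :
    ((\sum_(k < n) (if (r, 0 + k%:Z) \in shape 0 n a b then 1%N else 0))%R +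
    (a == Some r) + (b == Some r) = n)%N.
  rewrite -[RHS](@count_notched n (a == Some r) (b == Some r))//.
    congr (_ + _ + _)%N; apply: eq_bigr => k _; rewrite in_shape/= add0r.
    have kn := ltn_ord k.
    have -> : (k%:Z < 0 + n%:Z)%R = true by lia.
    have -> : (k%:Z + 1 == 0 + n%:Z)%R = (k.+1 == n) by lia.
    have -> : (k%:Z == 0)%R = (k == 0 :> nat) by lia.
    by rewrite /=; case: (~~ _ && ~~ _).
  by apply/negP => /and3P[/eqP n1 /eqP ar /eqP br]; move: nab; rewrite n1 ar br.
have addE (i j : nat) : (i + j)%R = (i + j)%N by [].
have := rowE true; have := rowE false; rewrite addE.
move: (\sum_(k < n) _)%R (\sum_(k < n) _)%R => i j.
by case: a b {rowE nab} => [[]|] [[]|] /=; rewrite ?addn0; lia.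
Qed.

Lemma notched_pgf_flip n a b :
  notched_pgf n (omap negb a) (omap negb b) = notched_pgf n a b.
Proof.
by rewrite /notched_pgf pgf_shape_flip; case: a b => [[]|] [[]|].
Qed.

Lemma notched_pgf_mirror n a b : notched_pgf n a b = notched_pgf n b a.
Proof.
by rewrite /notched_pgf pgf_shape_mirror [b == a]eq_sym;
  case: (a =P b) => [->|_]; rewrite ?andbF.
Qed.

(** The average over the relative position of the two notches. *)
Definition inner n : {poly R} :=
  2^-1 *: (notched_pgf n (Some true) (Some true) +
           notched_pgf n (Some true) (Some false)).
Definition outer n : {poly R} := notched_pgf n None (Some true).
Definition whole n : {poly R} := notched_pgf n None None.

Lemma sum_inner n r :
  notched_pgf n (Some true) (Some r) + notched_pgf n (Some false) (Some r) =
  2 *: inner n.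
Proof.
rewrite scalerA mulfV ?pnatr_eq0// scale1r; case: r.
  by rewrite [in LHS]addrC notched_pgf_mirror addrC.
by rewrite addrC -(notched_pgf_flip n (Some true) (Some true)).
Qed.

Lemma outerE n r : notched_pgf n None (Some r) = outer n.
Proof. by case: r => //; rewrite -(notched_pgf_flip n None (Some false)). Qed.

Lemma notched_pgfS n a b : notched_pgf n.+1 a b = pgf R (shape 0 n.+1 a b).
Proof. by []. Qed.

Lemma pgf_set0 l a b : pgf R (shape l 0 a b) = 1.
Proof.
rewrite -(pgf_fset0 R); congr pgf; apply/fsetP => s; rewrite in_shape in_fset0.
by apply/negP => /and3P[]; lia.
Qed.

Lemma inner0 : inner 0 = 2^-1%:P.
Proof. by rewrite /inner /notched_pgf /= pgf_set0 add0r -alg_polyC. Qed.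

Lemma outer0 : outer 0 = 1.
Proof. by rewrite /outer /notched_pgf/= pgf_set0. Qed.

Lemma inner1 : inner 1 = 2^-1 *: ('X + 1).
Proof.
rewrite /inner !notched_pgfS; congr (_ *: (_ + _)).
  have -> : shape 0 1 (Some true) (Some true) = [fset (false, 0)].
    apply/fsetP => -[[] i]; rewrite in_shape in_fset1/= xpair_eqE/=; lia.
  have := pgf_rec R [fset (false, 0 : int)]; rewrite cardfs1 scale1r => ->.
  rewrite big_seq_fset1 (_ : occupy _ _ = fset0) ?pgf_fset0 ?mulr1//.
  apply/fsetP => s; rewrite in_occupy in_fset1 in_fset0.
  by apply/negP => /and3P[/eqP->]; rewrite eqxx.
rewrite -(pgf_fset0 R); congr pgf; apply/fsetP => -[[] i];
  rewrite in_shape in_fset0/=; lia.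
Qed.

Lemma whole_rec n : n.+1%:R *: whole n.+1 =
    'X * \sum_(j < n.+1) outer j * outer (n - j).
Proof.
have := pgf_shape_rec 0 n.+1 None None.
rewrite (card_shape (ltn0Sn n)) ?orbT// !subn0.
rewrite -notched_pgfS -/(whole _) big_bool/=.
have sumE r :
    \sum_(k < n.+1) notched_pgf k None (Some r) * notched_pgf (n - k) (Some r) None =
    \sum_(j < n.+1) outer j * outer (n - j).
  by apply: eq_bigr => k _; rewrite outerE notched_pgf_mirror outerE.
rewrite !sumE -mulr2n mulrnAr -(scaler_nat 2 ('X * _)) natrM -scalerA.
by apply: scalerI; rewrite pnatr_eq0.
Qed.

Lemma outer_rec n : (2 * n + 1)%:R *: outer n.+1 =
  'X * (2 *: \sum_(j < n.+1) outer j * inner (n - j)).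
Proof.
have := pgf_shape_rec 0 n.+1 None (Some true).
rewrite (card_shape (ltn0Sn n)) ?orbT//=.
rewrite (_ : 2 * n.+1 - 0 - 1 = 2 * n + 1)%N; last by lia.
rewrite -notched_pgfS -/(outer _) => ->; rewrite big_bool/= -big_split/=.
congr (_ * _).
rewrite scaler_sumr; apply: eq_bigr => k _.
by rewrite !outerE -mulrDr sum_inner scalerAr.
Qed.

(** Adding the recurrences for notches in the same row and in opposite rows turns
    the right-hand side into a product of sums. *)
Lemma inner_rec n : n.+1%:R *: inner n.+2 =
  'X * \sum_(j < n.+2) inner j * inner (n.+1 - j).
Proof.
have rec (b : bool) : (2 * n.+1)%:R *: notched_pgf n.+2 (Some true) (Some b) =
    'X * \sum_(k < n.+2) \sum_(r : bool)
      notched_pgf k (Some true) (Some r) * notched_pgf (n.+1 - k) (Some r) (Some b).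
  have := pgf_shape_rec 0 n.+2 (Some true) (Some b).
  rewrite (card_shape (ltn0Sn _))//= (_ : 2 * n.+2 - 1 - 1 = 2 * n.+1)%N; last by lia.
  by rewrite exchange_big.
apply: (scalerI (_ : (2 * 2)%:R != 0 :> R)); first by rewrite pnatr_eq0.
rewrite scalerA -natrM /inner scalerA.
have -> : (2 * 2 * n.+1)%:R / 2 = (2 * n.+1)%:R :> R.
  by rewrite -mulnA natrM mulrAC mulfV ?pnatr_eq0// mul1r.
rewrite scalerDr !rec -mulrDr -big_split/= scalerAr; congr (_ * _).
rewrite scaler_sumr; apply: eq_bigr => k _.
rewrite -/(inner _) -/(inner _) !big_bool/=.
have sumb m r :
    notched_pgf m (Some r) (Some true) + notched_pgf m (Some r) (Some false) =
    2 *: inner m.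
  by rewrite !(notched_pgf_mirror m (Some r)) sum_inner.
rewrite addrACA -!mulrDr !sumb -mulrDl sumb.
by rewrite natrM -scalerA scalerAr scalerAl.
Qed.

Lemma ladder_shape n : ladder n = shape 1 n None None.
Proof.
apply/fsetP => -[r i]; rewrite in_shape/= andbT.
apply/imfset2P/andP => [[r' _ [k /=]]|[i1 i2]].
  by rewrite mem_iota => kn [_ ->]; split; lia.
exists r; first by case: r.
by exists `|i|%N; [rewrite mem_iota; lia|congr pair; lia].
Qed.

Lemma whole_ladder n : pgf R (ladder n) = whole n.
Proof.
by rewrite ladder_shape pgf_shape_translate /whole /notched_pgf eqxx andbF.
Qed.

End shape_recurrence.

(** * Centred moments *)
Section moments.
Context (R : realType).
Implicit Types (P Q : {poly R}) (a b c : R) (n : nat).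

(** First and second moments about [b] of the distribution with generating
    function [P], when [P] has total mass 1. *)
Definition mom1 b P : R := P^`().[1] - b * P.[1].
Definition mom2 b P : R :=
  P^`()^`().[1] + P^`().[1] - 2 * b * P^`().[1] + b ^+ 2 * P.[1].

Lemma mom1_XM a b P Q : mom1 (1 + a + b) ('X * (P * Q)) =
  mom1 a P * Q.[1] + P.[1] * mom1 b Q.
Proof.
rewrite /mom1 !derivM derivX !(hornerD, hornerM, hornerX, hornerC); ring.
Qed.

Lemma mom2_XM a b P Q : mom2 (1 + a + b) ('X * (P * Q)) =
  mom2 a P * Q.[1] + 2 * (mom1 a P * mom1 b Q) + P.[1] * mom2 b Q.
Proof.
rewrite /mom1 /mom2 !(derivM, derivD, derivX, derivC).
rewrite !(hornerD, hornerM, hornerX, hornerC); ring.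
Qed.

Lemma mom1Z c b P : mom1 b (c *: P) = c * mom1 b P.
Proof. by rewrite /mom1 derivZ !hornerZ; ring. Qed.

Lemma mom2Z c b P : mom2 b (c *: P) = c * mom2 b P.
Proof. by rewrite /mom2 !derivZ !hornerZ; ring. Qed.

Lemma mom1_sum I (r : seq I) b (F : I -> {poly R}) :
  mom1 b (\sum_(i <- r) F i) = \sum_(i <- r) mom1 b (F i).
Proof.
by rewrite /mom1 raddf_sum/= !horner_sum mulr_sumr -sumrB.
Qed.

Lemma mom2_sum I (r : seq I) b (F : I -> {poly R}) :
  mom2 b (\sum_(i <- r) F i) = \sum_(i <- r) mom2 b (F i).
Proof.
rewrite /mom2 !raddf_sum/= !horner_sum !mulr_sumr.
by rewrite -sumrN -!big_split.
Qed.

Section convolution.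
Variables (U W : nat -> {poly R}) (bU bW : nat -> R).

Definition moment0 (U : nat -> {poly R}) : fps R := fun n => (U n).[1].
Definition moment1 (bU : nat -> R) (U : nat -> {poly R}) : fps R :=
    fun n => mom1 (bU n) (U n).
Definition moment2 (bU : nat -> R) (U : nat -> {poly R}) : fps R :=
    fun n => mom2 (bU n) (U n).

Lemma mom1_conv n b : (forall j, (j <= n)%N -> b = 1 + bU j + bW (n - j)) ->
  mom1 b ('X * \sum_(j < n.+1) U j * W (n - j)) =
  (moment1 bU U * moment0 W + moment0 U * moment1 bW W) n.
Proof.
move=> bE; rewrite mulr_sumr mom1_sum fpsD !fpsM -big_split/=.
by apply: eq_bigr => j _; rewrite (bE j) ?mom1_XM// -ltnS.
Qed.

Lemma mom2_conv n b : (forall j, (j <= n)%N -> b = 1 + bU j + bW (n - j)) ->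
  mom2 b ('X * \sum_(j < n.+1) U j * W (n - j)) =
  (moment2 bU U * moment0 W + 2 * (moment1 bU U * moment1 bW W) +
    moment0 U * moment2 bW W) n.
Proof.
move=> bE; rewrite mulr_sumr mom2_sum !fpsD mulr_natl fpsMn !fpsM -mulr_natl.
rewrite mulr_sumr -!big_split/=.
by apply: eq_bigr => j _; rewrite (bE j) ?mom2_XM// -ltnS.
Qed.

End convolution.

Lemma eq_coef (f g : fps R) n : f = g -> f n = g n.
Proof. by move=> ->. Qed.

Lemma fpsM_eq_upto (s f g : fps R) n : (forall i, (i <= n)%N -> f i = g i) ->
  (s * f) n = (s * g) n.
Proof. by move=> fg; rewrite !fpsM; apply: eq_bigr => i _; rewrite fg ?leq_subr. Qed.

(** The value at [n.+1] is determined by the previous ones; the first [N + 1]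
    values are data. *)
Lemma conv_rec_uniq N (c : nat -> R) (s h f g : fps R) :
  (forall n, (n <= N)%N -> f n = g n) -> (forall n, (N <= n)%N -> c n != 0) ->
  (forall n, (N <= n)%N -> c n * f n.+1 = (s * f + h) n) ->
  (forall n, (N <= n)%N -> c n * g n.+1 = (s * g + h) n) -> f = g.
Proof.
move=> fg0 c0 fE gE; apply: fpsP => n.
suff : forall i, (i <= n)%N -> f i = g i by apply.
elim: n => [|n IH] i.
  by rewrite leqn0 => /eqP->; apply: fg0.
rewrite leq_eqVlt => /predU1P[->|]; last by rewrite ltnS; exact: IH.
have [nN|nN] := leqP n.+1 N; first exact: fg0.
by apply: (mulfI (c0 n nN)); rewrite fE// gE// !fpsD (fpsM_eq_upto s IH).
Qed.

End moments.

(** * Moments of the pieces and of the ladder *)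
Section seating_moments.
Context (R : realType).
Local Notation z := (fpsX R).
Local Notation w := (geom R).
Local Notation kap := (kap R).
Local Notation k := (fps_const kap).

Definition speed : R := 1 - 2 * kap.
(** The slope is the asymptotic mean per column; the constants are those for which
    the centres of the two pieces, plus the occupied seat, add up to the centre of
    the original piece. *)
Definition shift_inner n : R := speed * n%:R + speed - 1.
Definition shift_outer n : R := speed * n%:R.
Definition shift_whole n : R := speed * n%:R + 1 - speed.

Lemma moment0_inner : moment0 (inner R) = inner_m0 R.
Proof.
apply: fpsP => -[|n]; rewrite /moment0 /inner_m0/=; first by rewrite inner0 hornerC.
by rewrite /inner !notched_pgfS hornerZ hornerD !pgf1 mulVf ?pnatr_eq0.
Qed.

Lemma moment0_outer : moment0 (outer R) = w.
Proof.
apply: fpsP => -[|n]; rewrite /moment0 /geom/=; first by rewrite outer0 hornerC.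
by rewrite /outer !notched_pgfS pgf1.
Qed.

Lemma coef_zD (f : fps R) n : (z * fderiv f - f) n.+1 = n%:R * f n.+1.
Proof. by rewrite fpsD fpsN fpsXS fderivE -natr1 mulrDl mul1r addrK. Qed.

Lemma coef_2zD (f : fps R) n :
  (2 * z * fderiv f - f) n.+1 = (2 * n + 1)%:R * f n.+1.
Proof.
rewrite fpsD fpsN -mulrA mulr_natl fpsMn fpsXS fderivE.
by rewrite natrD natrM -natr1 -mulr_natl; ring.
Qed.

Let bS j n : (j <= n)%N ->
  shift_inner n.+1 = 1 + shift_inner j + shift_inner (n - j).
Proof. by move=> jn; rewrite /shift_inner natrB// -natr1; ring. Qed.

Let bY j n : (j <= n)%N ->
  shift_outer n.+1 = 1 + shift_outer j + shift_inner (n - j).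
Proof. by move=> jn; rewrite /shift_inner /shift_outer natrB// -natr1; ring. Qed.

Let bX j n : (j <= n)%N ->
  shift_whole n.+1 = 1 + shift_outer j + shift_outer (n - j).
Proof. by move=> jn; rewrite /shift_whole /shift_outer natrB// -natr1; ring. Qed.

Lemma tail2_coef0 : tail2 R 0%N = 4 * kap - 2^-1.
Proof.
rewrite /tail2 fpsM big_ord1 mulr1 fpsD /tail1 fpsM big_ord1 mulr1 fpsD fpsN.
rewrite mulr_natl fpsMn /half_exp/= expr0 mul1r invr1 mul1r.
rewrite -[k 0%N]/kap; ring.
Qed.

Lemma first_moment_inner : moment1 shift_inner (inner R) = inner_m1 R.
Proof.
apply: (@conv_rec_uniq _ 1 (fun n => n%:R) (2 * inner_m0 R) 0).
- case=> [|[|//]] _.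
    rewrite /moment1 inner0 /mom1 derivC hornerC hornerC /shift_inner /speed.
    rewrite /inner_m1 fpsD fpsX0 /fps_const/=.
    by field.
  rewrite /moment1 inner1 /mom1 derivZ derivD derivX derivC !hornerZ !hornerD.
  rewrite hornerX !hornerC /shift_inner /speed /inner_m1 fpsD fpsXS tail2_coef0
    /fps_const/=.
  by field.
- by case=> // n _; rewrite pnatr_eq0.
- case=> // n _; rewrite -mom1Z inner_rec (@mom1_conv _ _ _ shift_inner shift_inner).
    by rewrite moment0_inner addr0; apply: eq_coef; ring.
  by move=> j; exact: bS.
- case=> // n _; rewrite -coef_zD inner_m1_ode addr0.
  rewrite fpsD fpsN fpsXS (_ : (k * (1 + z)) n.+2 = 0) ?subr0//.
  by rewrite fps_constE fpsD fps1 /fpsX/= addr0 mulr0.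
Qed.

Lemma coef_geom2 n : (w ^+ 2) n = n.+1%:R.
Proof. by rewrite -fderiv_geom fderivE mulr1. Qed.

Let inner_m2_low : inner_m2 R =
  fps_const (12 * kap ^+ 2) * w ^+ 2 + (fps_const (- 10 * kap ^+ 2)
  + z * (fps_const (- 8 * kap ^+ 2) + (fps_const (- 8 * kap) * tail2 R +
    (fps_const 2 * tail2 R ^+ 2 + z * (- 2 * tail2 R ^+ 2 - 4 * k * tail2 R))))).
Proof. by rewrite /inner_m2 /inner_m2_entire; move: (tail2 R) w z => *; ring. Qed.

Let inner_m2_coef0 : inner_m2 R 0%N = 2 * kap ^+ 2.
Proof.
rewrite inner_m2_low !fpsD fps_constE coef_geom2 fpsX0.
rewrite -[fps_const _ 0%N]/(- 10 * kap ^+ 2); ring.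
Qed.

Let inner_m2_coef1 : inner_m2 R 1%N = 16 * kap ^+ 2 - 4 * kap + 2^-1.
Proof.
rewrite inner_m2_low fpsD fps_constE coef_geom2 fpsD fpsXS !fpsD !fps_constE fpsX0.
rewrite (expr2 (tail2 R)) fpsM big_ord1 tail2_coef0.
by rewrite -[fps_const _ 0%N]/(- 8 * kap ^+ 2) /fps_const/=; field.
Qed.

Lemma second_moment_inner : moment2 shift_inner (inner R) = inner_m2 R.
Proof.
apply: (@conv_rec_uniq _ 1 (fun n => n%:R) (2 * inner_m0 R) (2 * inner_m1 R ^+ 2)).
- case=> [|[|//]] _.
    rewrite /moment2 inner0 /mom2 !derivC !hornerC /shift_inner /speed inner_m2_coef0.
    by field.
  rewrite /moment2 inner1 /mom2 !(derivZ, derivD, derivX, derivC) addr0 !hornerZ.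
  rewrite !(hornerD, hornerX, hornerC, derivC, horner0) inner_m2_coef1
    /shift_inner /speed.
  by field.
- by case=> // n _; rewrite pnatr_eq0.
- case=> // n _; rewrite -mom2Z inner_rec (@mom2_conv _ _ _ shift_inner shift_inner).
    by rewrite moment0_inner first_moment_inner; apply: eq_coef; ring.
  by move=> j; exact: bS.
- case=> // n _; rewrite -coef_zD inner_m2_ode.
  rewrite (_ : 2 * k ^+ 2 = fps_const (2 * kap ^+ 2)); last by ring.
  rewrite (_ : 4 * k ^+ 2 = fps_const (4 * kap ^+ 2)); last by ring.
  by rewrite fpsD fpsD !fpsN fps_constE fpsXS /fpsX/= mulr0 /fps_const/= !subr0.
Qed.

Lemma first_moment_outer : moment1 shift_outer (outer R) = outer_dm1 R * w.
Proof.
apply: (@conv_rec_uniq _ 0 (fun n => (2 * n + 1)%:R) (2 * inner_m0 R)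
  (2 * (w * inner_m1 R))).
- case=> // _; rewrite /moment1 outer0 /mom1 derivC !hornerC /shift_outer.
  rewrite mulr0 mul0r subr0.
  by rewrite fpsM big_ord1 outer_dm1_coef0 mul0r.
- by move=> n _; rewrite pnatr_eq0 addn1.
- move=> n _; rewrite -mom1Z outer_rec -scalerAr mom1Z.
  rewrite (@mom1_conv _ _ _ shift_outer shift_inner).
    rewrite moment0_inner moment0_outer first_moment_inner.
    rewrite -fps_constE rmorph_nat; apply: eq_coef; ring.
  by move=> j; exact: bY.
- move=> n _; rewrite -coef_2zD outer_m1_ode fpsXS; apply: eq_coef; ring.
Qed.

Lemma second_moment_outer : moment2 shift_outer (outer R) = outer_dm2 R * w.
Proof.
apply: (@conv_rec_uniq _ 0 (fun n => (2 * n + 1)%:R) (2 * inner_m0 R)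
  (4 * (outer_dm1 R * w * inner_m1 R) + 2 * (w * inner_m2 R))).
- case=> // _; rewrite /moment2 outer0 /mom2 !derivC !hornerC /shift_outer mulr0.
  by rewrite fpsM big_ord1 outer_dm2_coef0; ring.
- by move=> n _; rewrite pnatr_eq0 addn1.
- move=> n _; rewrite -mom2Z outer_rec -scalerAr mom2Z.
  rewrite (@mom2_conv _ _ _ shift_outer shift_inner).
    rewrite moment0_inner moment0_outer first_moment_inner first_moment_outer
      second_moment_inner.
    rewrite -fps_constE rmorph_nat; apply: eq_coef; ring.
  by move=> j; exact: bY.
- move=> n _; rewrite -coef_2zD outer_m2_ode fpsXS; apply: eq_coef; ring.
Qed.

Lemma first_moment_whole n :
  n.+1%:R * mom1 (shift_whole n.+1) (whole R n.+1) = (2 * outer_dm1 R * w ^+ 2) n.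
Proof.
rewrite -mom1Z whole_rec (@mom1_conv _ _ _ shift_outer shift_outer).
  by rewrite moment0_outer first_moment_outer; apply: eq_coef; ring.
by move=> j; exact: bX.
Qed.

Lemma second_moment_whole n :
  n.+1%:R * mom2 (shift_whole n.+1) (whole R n.+1) =
  (2 * outer_dm2 R * w ^+ 2 + 2 * outer_dm1 R ^+ 2 * w ^+ 2) n.
Proof.
rewrite -mom2Z whole_rec (@mom2_conv _ _ _ shift_outer shift_outer).
  rewrite moment0_outer first_moment_outer second_moment_outer; apply: eq_coef; ring.
by move=> j; exact: bX.
Qed.

End seating_moments.

(** * Asymptotic expansions *)
Section final.
Context (R : realType).
Local Notation z := (fpsX R).
Local Notation y := (1 - fpsX R).
Local Notation w := (geom R).
Local Notation kap := (kap R).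
Local Notation k := (fps_const kap).

(** The recurrence of the whole ladder has [n W_n] on the left-hand side. *)
Definition div_index (f : fps R) : fps R :=
  fun n => if n is m.+1 then f m / m.+1%:R else 0.

Lemma decays_div_index M j f : (0 < M)%N -> decays M j f -> decays M j (div_index f).
Proof.
move=> M0 [C fC]; have C0 := decays_coef_ge0 M0 fC.
apply: (@decays_eventually _ M j 1 (C * j.+1%:R)) => // -[//|n] _.
rewrite /div_index normrM normfV normr_nat ler_pdivrMr//.
apply: le_trans (fC n) _; rewrite -!mulrA ler_wpM2l// /decay_bound addSn factS natrM.
have M1 : M%:R ^+ n <= M%:R ^+ n.+1 :> R.
  by rewrite exprS ler_peMl ?exprn_ge0// ler1n.
have f0 : 0 < (n + j)`!%:R :> R by rewrite ltr0n fact_gt0.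
have nj0 : 0 < (n + j).+1%:R :> R by rewrite ltr0n.
have njle : (n + j).+1%:R <= j.+1%:R * n.+1%:R :> R.
  by rewrite -natrM ler_nat; lia.
rewrite [leRHS](_ : _ = M%:R ^+ n.+1 / (n + j)`!%:R *
  (j.+1%:R * n.+1%:R / (n + j).+1%:R)); last first.
  move: f0 nj0; move: ((n + j)`!%:R : R) ((n + j).+1%:R : R) => f' d f0 d0.
  by field; rewrite ?gt_eqF.
apply: le_trans (_ : M%:R ^+ n.+1 / (n + j)`!%:R <= _).
  by rewrite ler_wpM2r// invr_ge0.
by rewrite ler_peMr ?mulr_ge0 ?exprn_ge0 ?invr_ge0// ler_pdivlMr// mul1r.
Qed.

Lemma decays_pointwise_sqr j (f : fps R) : decays 1 j f ->
  decays 1 j (fun n => f n ^+ 2).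
Proof.
move=> [C fC]; have C0 := decays_coef_ge0 (ltn0Sn 0) fC.
exists (C ^+ 2) => n; rewrite normrX expr2.
have b1 : decay_bound R 1 j n <= 1.
  by rewrite /decay_bound expr1n mul1r invf_le1 ?ltr0n ?fact_gt0// ler1n fact_gt0.
apply: le_trans (ler_pM _ _ (fC n) (fC n)) _ => //.
rewrite mulrACA -expr2 ler_wpM2l ?sqr_ge0// ler_piMl ?decay_bound_ge0//.
Qed.

(** Dividing [outer_dm1] by [(1 - z)^2] turns its value at [1] into a constant
    mean, the double zero leaving an entire remainder. *)
Lemma mean_whole K : at1 (inv_odd_fact R) K ->
  exists2 x1 : fps R, decays 1 3 x1 &
    forall n, mom1 (shift_whole R n.+1) (whole R n.+1) = 4 * kap * (K - 1) + x1 n.+1.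
Proof.
move=> /outer_dm1_expansion[q2 dq2 qE].
exists (div_index (2 * q2)).
  by apply: decays_div_index => //; exact: decays_natM.
move=> n; apply: (mulfI (_ : n.+1%:R != 0 :> R)); first by rewrite pnatr_eq0.
rewrite first_moment_whole qE.
have -> : 2 * (fps_const (2 * kap * (K - 1)) + y ^+ 2 * q2) * w ^+ 2 =
   fps_const (4 * kap * (K - 1)) * w ^+ 2 + 2 * q2.
  apply: (lincomb (c := 2 * q2 * (y * w + 1)) (y_geom R)).
  by move: (geom R) (fpsX R) => *; ring.
rewrite fpsD fps_constE coef_geom2 /div_index.
have n0 : n.+1%:R != 0 :> R by rewrite pnatr_eq0.
by move: n0; move: (n.+1%:R : R) ((2 * q2) n) => d c d0; field.
Qed.

Lemma coef_z_geom3 n : (2 * z * w ^+ 3) n = n%:R * n.+1%:R.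
Proof.
have -> : 2 * z * w ^+ 3 = z * fderiv (w ^+ 2).
  by rewrite expr2 fderivM fderiv_geom; ring.
by case: n => [|n]; rewrite ?fpsX0 ?mul0r// fpsXS fderivE coef_geom2.
Qed.

(** The pole and the constant of [outer_dm2] give the linear term and part of the
    constant; the square of the value of [outer_dm1] gives the rest. *)
Lemma second_moment_whole_expansion K : at1 (inv_odd_fact R) K ->
  exists2 x2 : fps R, decays 2 4 x2 &
    forall n, mom2 (shift_whole R n.+1) (whole R n.+1) =
      12 * kap ^+ 2 * n%:R + 2 * outer_m2_const K + 8 * kap ^+ 2 * (K - 1) ^+ 2
        + x2 n.+1.
Proof.
move=> DK; have [q2 dq2 qE] := outer_dm1_expansion DK.
have [r dr uE] := outer_dm2_expansion DK.
pose t := 2 * r + 4 * (fps_const (2 * kap * (K - 1)) * q2)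
  + 2 * ((y * q2) * (y * q2)).
have dt : decays 2 4 t.
  apply: decaysD; first apply: decaysD.
  - exact: decays_natM.
  - by apply/decays_natM/decays_constM; exact: decays_widen dq2.
  - by apply: decays_natM; apply: (@decaysM _ 1 1 2 2) => //; exact: decaysyM.
exists (div_index t); first exact: decays_div_index.
move=> n; apply: (mulfI (_ : n.+1%:R != 0 :> R)); first by rewrite pnatr_eq0.
rewrite second_moment_whole qE uE.
have -> :
    2 * (12 * k ^+ 2 * z * w + fps_const (outer_m2_const K) + y ^+ 2 * r) * w ^+ 2 +
    2 * (fps_const (2 * kap * (K - 1)) + y ^+ 2 * q2) ^+ 2 * w ^+ 2 =
    fps_const (12 * kap ^+ 2) * (2 * z * w ^+ 3) +
    fps_const (2 * outer_m2_const K + 8 * kap ^+ 2 * (K - 1) ^+ 2) * w ^+ 2 + t.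
  apply: (lincomb (c := (2 * r + 4 * fps_const (2 * kap * (K - 1)) * q2
    + 2 * y ^+ 2 * q2 ^+ 2) * (y * w + 1)) (y_geom R)).
  rewrite /t; move: (outer_m2_const K) (geom R) (fpsX R) => *; ring.
rewrite !fpsD !fps_constE coef_z_geom3 coef_geom2 /div_index.
have n0 : n.+1%:R != 0 :> R by rewrite pnatr_eq0.
by move: n0; move: (n.+1%:R : R) (t n) (outer_m2_const K) => d c c' d0; field.
Qed.

End final.

Lemma decays_bigO (R : realType) (M j : nat) (f g : nat -> R) (e : fps R) :
  decays M j e -> (forall n, f n.+1 = g n.+1 + e n.+1) ->
  f = g +O_\oo (fun n : nat => M%:R ^+ n / ((n + j)`!)%:R : R).
Proof.
move=> [C eC] fE; apply/eqaddOP/bigO_exP; exists (`|C| + 1).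
  by rewrite ltr_wpDl.
exists 1%N => // -[//|n] _.
rewrite [X in `|X|](_ : _ = e n.+1); last first.
  by rewrite -[LHS]/(f n.+1 - g n.+1) fE addrAC subrr add0r.
apply: le_trans (eC n.+1) _.
rewrite -[X in (_ <= _ * `|X|)]/(decay_bound R M j n.+1).
rewrite (ger0_norm (decay_bound_ge0 R M j n.+1)) ler_wpM2r ?decay_bound_ge0//.
by rewrite (le_trans (ler_norm C))// lerDl.
Qed.

Theorem theorem1 (R : realType) :
  let mu : R := 1 - expR (- 1) / 2 in
  let phi : R := 2 * Phi 1 - 1 in
  let c1 : R := expR (- 1) / 2 * (Num.sqrt (2 * pi * expR 1) * phi - 1) in
  let sigma : R := Num.sqrt (3 / 4) * expR (- 1) in
  let c2 : R := expR (- 2) / 4 *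
    (- (pi * expR 1 * phi ^+ 2) - 2 * Num.sqrt (2 * pi * expR 1) * phi + 5) in
  let EX (n : nat) : R := fine ('E_(seating_law R (ladder n))[occupied R])%E in
  let VX (n : nat) : R := fine ('V_(seating_law R (ladder n))[occupied R])%E in
  (EX = (fun n : nat => mu * n%:R + c1)
        +O_\oo (fun n : nat => 1 / ((n + 3)`!)%:R : R)) /\
  (VX = (fun n : nat => sigma ^+ 2 * n%:R + c2)
        +O_\oo (fun n : nat => 2 ^+ n / ((n + 4)`!)%:R : R)).
Proof.
move=> mu phi c1 sigma c2 EX VX.
pose K := Num.sqrt (2 * pi * expR 1) * phi / 2.
have DK : at1 (inv_odd_fact R) K by exact: at1_inv_odd_fact.
have [x1 dx1 x1E] := mean_whole DK.
have [x2 dx2 x2E] := second_moment_whole_expansion DK.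
have e1 : expR (-1) = 4 * kap R :> R by rewrite /kap; field.
have e2 : expR (-2) = 16 * kap R ^+ 2 :> R.
  have -> : -2 = -1 - 1 :> R by ring.
  by rewrite expRD e1; ring.
have sK : Num.sqrt (2 * pi * expR 1) * phi = 2 * K.
  by rewrite /K mulrCA mulfV ?mulr1.
have pK : pi * expR 1 * phi ^+ 2 = 2 * K ^+ 2.
  have : (Num.sqrt (2 * pi * expR 1) * phi) ^+ 2 = (2 * K) ^+ 2 by rewrite sK.
  rewrite exprMn sqr_sqrtr; first by move=> h; lra.
  by rewrite !mulr_ge0 ?pi_ge0 ?expR_ge0.
have EXE n : EX n = mom1 0 (whole R n).
  by rewrite /EX expectation_occupied whole_ladder /mom1 mul0r subr0.
have mE n : (whole R n).[1] = 1 by rewrite -whole_ladder pgf1.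
have EXS n : EX n.+1 = mu * n.+1%:R + c1 + x1 n.+1.
  have := x1E n; rewrite EXE /mom1 mE mul0r subr0 mulr1 => /eqP.
  rewrite subr_eq => /eqP ->; rewrite /shift_whole /speed /mu /c1 sK e1.
  by field.
have VXS n : VX n.+1 = sigma ^+ 2 * n.+1%:R + c2 +
    (x2 n.+1 - 8 * kap R * (K - 1) * x1 n.+1 - x1 n.+1 ^+ 2).
  (* The choice of the centre does not affect the variance. *)
  have -> : VX n.+1 = mom2 (shift_whole R n.+1) (whole R n.+1) -
      mom1 (shift_whole R n.+1) (whole R n.+1) ^+ 2.
    by rewrite /VX variance_occupied whole_ladder /= /mom1 /mom2 mE; ring.
  rewrite /sigma exprMn sqr_sqrtr ?divr_ge0// x1E x2E.
  rewrite /c2 e1 e2 pK -(mulrA 2 (Num.sqrt _)) sK /outer_m2_const -natr1.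
  by field.
split.
  rewrite (_ : (fun n : nat => 1 / ((n + 3)`!)%:R : R) =
    fun n : nat => 1%:R ^+ n / ((n + 3)`!)%:R); last first.
    by apply/funext => n; rewrite expr1n.
  exact: (@decays_bigO _ _ _ _ _ _ dx1 EXS).
apply: (@decays_bigO R 2 4 VX _ (fun n => x2 n -
  8 * kap R * (K - 1) * x1 n - x1 n ^+ 2)) => //.
have dx1w f : decays 1 3 f -> decays 2 4 f by exact: decays_widen.
apply: decaysB; last exact/dx1w/decays_pointwise_sqr.
apply: decaysB => //; apply: dx1w.
have := decays_constM (8 * kap R * (K - 1)) dx1.
rewrite (_ : _ * x1 = fun n => 8 * kap R * (K - 1) * x1 n)//.
by apply/funext => n; exact: fps_constE.
Qed.
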